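(* Let $G\subset\mathbb{R}^2$ be a set that does not surround the origin. Then $$\mathbb{P}\big[nG\cap\widehat S_{[0,\infty)}=\emptyset\ \text{ for infinitely many positive integers } n\big]=1.$$
   Context: For $x,y\in\mathbb{Z}^2$ write $x\sim y$ if $x$ and $y$ are nearest neighbours in $\mathbb{Z}^2$. Let $(S_k)_{k\ge0}$ be the simple random walk on $\mathbb{Z}^2$ (transition probability $1/4$ to each neighbour). Its potential kernel is $$a(x)=\sum_{k=0}^\infty\big(\mathbb{P}_0[S_k=0]-\mathbb{P}_x[S_k=0]\big),\qquad x\in\mathbb{Z}^2,$$ where $\mathbb{P}_x$ is the law of the walk started at $x$; the series converges, $a(0)=0$, $a(x)>0$ for $x\ne0$, $a(x)=1$ for $x\sim 0$, and $\frac14\sum_{y\sim x}a(y)=a(x)$ for all $x\neq 0$. The conditioned walk $(\widehat S_k)_{k\ge 0}$ is the Markov chain on $\mathbb{Z}^2\setminus\{0\}$ with transition probabilities $\widehat P_{xy}=\frac{a(y)}{4a(x)}$ if $x\sim y$ (and $x\ne 0$), and $\widehat P_{xy}=0$ otherwise. It is started at a fixed neighbour $x_0$ of the origin, and $\mathbb{P}$ denotes the corresponding probability. Its range is $\widehat S_{[0,\infty)}=\bigcup_{m\ge0}\{\widehat S_m\}$. For $G\subset\mathbb{R}^2$, $nG=\{nx:x\in G\}$. Definition. A set $G\subset\mathbb{R}^2$ does not surround the origin if: (i) there exists $c_1>0$ such that $G\subset\{x\in\mathbb{R}^2:\|x\|\le c_1\}$ (so $G$ is bounded); and (ii) for this $c_1$,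 there exist $c_2>0$, $c_3>0$ and a (differentiable) function $f=(f_1,f_2):[0,1]\to\mathbb{R}^2$ such that $f(0)=0$, $\|f(1)\|=c_1$, $|f_1'(s)|+|f_2'(s)|\le c_2$ for all $s\in[0,1]$, and $$\inf_{s\in[0,1],\,y\in G}\|(f_1(s),f_2(s))-y\|\ge c_3.$$ Here $\|\cdot\|$ is the Euclidean norm. *)

(* Defs.v *)
From mathcomp Require Import all_boot all_order all_algebra.
From mathcomp Require Import all_classical all_reals all_analysis.

Set Implicit Arguments.
Unset Strict Implicit.
Unset Printing Implicit Defensive.

Import Order.TTheory GRing.Theory Num.Theory.
Import numFieldNormedType.Exports.

Local Open Scope classical_set_scope.
Local Open Scope ring_scope.

Notation Z2 := (int * int)%type.

Definition nn (x y : Z2) : bool := `|x.1 - y.1| + `|x.2 - y.2| == 1 :> int.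

Definition step (i : 'I_4) : Z2 :=
  nth (0, 0) [:: (1, 0); (-1, 0); (0, 1); (0, -1)] i.

(* [srw_prob R k x y] is P_x[S_k = y]: the 4 ^ k sequences of k unit steps are
   equally likely, and we count those leading from x to y. *)
Definition srw_prob (R : realType) (k : nat) (x y : Z2) : R :=
  #|[pred e : {ffun 'I_k -> 'I_4} | x + \sum_(i < k) step (e i) == y]|%:R
    / 4 ^+ k.

(* For x.1 + x.2 odd the terms alternate in sign and the series converges only
   conditionally, so the sum has to be a limit of partial sums. *)
Definition potential_kernel (R : realType) (x : Z2) : R :=
  limn (series (fun k => srw_prob R k 0 0 - srw_prob R k x 0)).

Notation Z2_star := {x : Z2 | x != 0}.

Definition conditioned_trans (R : realType) (x y : Z2_star) : R :=
  if nn (val x) (val y)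
  then potential_kernel R (val y) / (4 * potential_kernel R (val x))
  else 0.

(* The Markov property is multiplied out, so that conditioning on null events
   needs no convention.  Measurability is stated on singletons, which is enough
   for the discrete sigma-algebra since the state space is countable. *)
Definition markov_chain (R : realType) (d : measure_display)
    (T : measurableType d) (P : probability T R) (E : countType)
    (Q : E -> E -> R) (x0 : E) (X : nat -> T -> E) : Prop :=
  [/\ forall (k : nat) (x : E), measurable [set w | X k w = x],
      P [set w | X 0%N w = x0] = 1%E &
      forall (n : nat) (p : nat -> E),
        P [set w | forall k : nat, (k <= n.+1)%N -> X k w = p k] =
        (P [set w | forall k : nat, (k <= n)%N -> X k w = p k] *
         (Q (p n) (p n.+1))%:E)%E].

(* The norm provided by the library on [R * R] is the sup norm. *)
Definition enorm (R : realType) (x : R * R) : R :=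
  Num.sqrt (x.1 ^+ 2 + x.2 ^+ 2).

(* Derivative of a function on [0, 1], one-sided at the endpoints; the values
   of [f] outside [0, 1] are irrelevant. *)
Definition is_derive01 (R : realType) (f : R -> R) (s l : R) : Prop :=
  (f t - f s) / (t - s) @[t --> within [set` `[0, 1]] s^'] --> l.

(* The infimum is taken in the extended reals, so it is +oo if G is empty. *)
Definition does_not_surround_origin (R : realType) (G : set (R * R)) : Prop :=
  exists c1 : R, [/\ 0 < c1, G `<=` [set x | enorm x <= c1] &
    exists (c2 c3 : R) (f1 f2 df1 df2 : R -> R),
      [/\ 0 < c2 /\ 0 < c3,
          (f1 0, f2 0) = (0, 0),
          enorm (f1 1, f2 1) = c1,
          forall s : R, 0 <= s <= 1 ->
            [/\ is_derive01 f1 s (df1 s), is_derive01 f2 s (df2 s) &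
                `|df1 s| + `|df2 s| <= c2] &
          (c3%:E <= ereal_inf [set r : \bar R | exists (s : R) (y : R * R),
             [/\ (0 <= s <= 1)%R, G y &
                 r = (enorm (f1 s - y.1, f2 s - y.2))%:E]])%E]].

Definition dilate (R : realType) (n : nat) (G : set (R * R)) : set (R * R) :=
  [set (n%:R * x.1, n%:R * x.2) | x in G].

Definition Z2_to_R2 (R : realType) (x : Z2) : R * R := (x.1%:~R, x.2%:~R).

Definition walk_range (R : realType) (X : nat -> Z2_star) : set (R * R) :=
  \bigcup_(m : nat) [set Z2_to_R2 R (val (X m))].
Arguments walk_range R X : clear implicits.

(* Main.v *)
Require Import Defs.
From mathcomp Require Import all_boot all_order all_algebra.
From mathcomp Require Import all_classical all_reals all_analysis.
From mathcomp Require Import zify ring lra.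

(** Write [a] for the potential kernel and [n_k = 2 ^ (h + k)]. The
    conditioned walk is the simple random walk killed at the origin,
    reweighted along each path by the ratio of the values of [a] at its two
    ends ([pr_history_ge]). Hence probabilities of events of the conditioned
    walk can be bounded by exhibiting functions that are sub- or
    supermartingales for the killed walk ([walk_sum_sub], [walk_sum_super]);
    the natural building blocks are [a] itself and its translates, which are
    harmonic off their pole. The one fact needed about [a] is that it is a
    logarithm up to a bounded error ([potential_kernel_bounds]), and this
    follows from the product structure of the walk in rotated coordinates.

    Fix a scale [2 ^ k]. Dilated by [n_k], the path that connects the origin
    to the boundary of the disc containing [G], prolonged radially, is
    surrounded by a corridor of width comparable to [2 ^ k] that avoids
    [n_k G] ([surrounding_corridor]). Let [E_k] be the event that the walk follows
    the corridor to its end and never comes back to the disc containing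
    [n_k G]; on this event the range of the walk avoids [n_k G]. Following the
    corridor costs a constant, and never coming back costs a factor of order
    [1 / k], since, away from the origin, [1 - r / a] is a martingale for a
    constant [r], and [a] has order [k] at distance [2 ^ k]. So [E_k] has
    probability at least of order [1 / k] ([corridor_survival]), a divergent
    series.

    The events at different scales are not independent, but two of them, at
    scales [k < j], have joint probability at most of order [1 / (k (j - k))]
    ([pair_survival]): after the first escape the walk still has to escape
    from scale [j], conditionally on not returning to scale [k]. The second
    moment method over a long enough range of scales therefore yields some
    [E_k] with a probability bounded below, and this bound is uniform over all
    pasts of the walk, because a given past is negligible at large scales
    ([some_survives_lower]). An event whose conditional probability given any
    finite past is at most [1 - delta] has probability 0, so that almost
    surely [E_k] occurs for infinitely many [k] ([eventually_fail_null]). *)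

Set Implicit Arguments.
Unset Strict Implicit.
Unset Printing Implicit Defensive.

Import Order.TTheory GRing.Theory Num.Theory.
Import numFieldNormedType.Exports.

Local Open Scope classical_set_scope.
Local Open Scope ring_scope.

(** * The simple random walk on the line *)

Section LineProb.
Variable R : realType.

Fixpoint line_prob (k : nat) (u : int) : R :=
  if k is k'.+1 then (line_prob k' (u - 1) + line_prob k' (u + 1)) / 2
  else (u == 0)%:R.

Lemma line_prob_ge0 k u : 0 <= line_prob k u.
Proof. elim: k u => [|k IH] u /=; [by case: eqP|have := IH (u-1); have := IH (u+1); lra]. Qed.

Lemma line_probN k u : line_prob k (- u) = line_prob k u.
Proof.
elim: k u => [|k IH] u /=; first by rewrite oppr_eq0.
have -> : - u - 1 = - (u + 1) by lia.
have -> : - u + 1 = - (u - 1) by lia.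
by rewrite !IH addrC.
Qed.

Lemma line_prob_parity k (u : int) : odd (k + `|u|%N) -> line_prob k u = 0.
Proof.
elim: k u => [|k IH] u /=.
  by case: eqP => [->|//].
move=> H; rewrite !IH ?addr0 ?mul0r //; lia.
Qed.

(** By induction on the time: averaging preserves symmetry and unimodality
    along each parity class. *)
Lemma line_prob_mono2 k (u : int) : 0 <= u -> line_prob k (u + 2) <= line_prob k u.
Proof.
elim: k u => [|k IH] u u0 /=.
  by rewrite (_ : u + 2 == 0 = false) ?ler0n //; apply/eqP; lia.
have -> : u + 2 - 1 = u + 1 by lia.
have -> : u + 2 + 1 = (u + 1) + 2 by lia.
have h1 : line_prob k (u + 1 + 2) <= line_prob k (u + 1) by apply: IH; lia.
have h2 : line_prob k (u + 1) <= line_prob k (u - 1).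
  have [->|un0] := eqVneq u 0; first by rewrite sub0r add0r line_probN.
  have -> : u + 1 = u - 1 + 2 by lia.
  by apply: IH; lia.
lra.
Qed.

Lemma line_prob_antimono k (u : int) (j : nat) : 0 <= u ->
  line_prob k (u + (j.*2)%:Z) <= line_prob k u.
Proof.
move=> u0; elim: j => [|j IH]; first by rewrite addr0.
apply: le_trans IH.
have -> : u + (j.+1.*2)%:Z = u + (j.*2)%:Z + 2 by lia.
by apply: line_prob_mono2; lia.
Qed.

Lemma line_prob_absz k u : line_prob k `|u|%N%:Z = line_prob k u.
Proof.
have [u0|u0] := leP 0 u; first by congr line_prob; lia.
by rewrite -line_probN; congr line_prob; lia.
Qed.

Lemma line_prob_even_antimono k (u v : int) : ~~ odd `|u|%N -> ~~ odd `|v|%N ->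
  (`|u| <= `|v|)%N -> line_prob k v <= line_prob k u.
Proof.
move=> ou ov uv; rewrite -(line_prob_absz k u) -(line_prob_absz k v).
have -> : `|v|%N%:Z = `|u|%N%:Z + ((`|v| - `|u|)./2.*2)%:Z by lia.
exact: line_prob_antimono.
Qed.

(** This is the ratio of consecutive binomial coefficients. The induction on
    time uses it at both neighbours of [u], which is why it is stated for all
    integers, including those where the kernel vanishes. All estimates of the
    kernel below derive from it. *)
Lemma line_prob_rec2 k (u : int) :
  (k%:R + u%:~R + 2) * line_prob k (u + 2) = (k%:R - u%:~R) * line_prob k u.
Proof.
elim: k u => [|k IH] u /=.
  have [->|/eqP u0] := eqVneq u 0; first by rewrite /= subr0 mul0r mulr0.
  rewrite !mulr0.
  have [e|] := eqVneq (u + 2) 0; rewrite ?mulr0 //.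
  have -> : u = -2 by lia.
  by rewrite rmorphN /= ; ring.
have -> : u + 2 - 1 = u + 1 by lia.
have -> : u + 2 + 1 = (u + 1) + 2 by lia.
have h1 := IH (u + 1); have h2 := IH (u - 1).
rewrite (_ : u - 1 + 2 = u + 1) in h2; last by lia.
rewrite -(natr1 k) !rmorphD rmorphN /= in h1 h2 *.
lra.
Qed.

Definition beta (m : nat) : R := line_prob m.*2 0.

Lemma beta_ge0 m : 0 <= beta m. Proof. exact: line_prob_ge0. Qed.

(** The return probabilities obey the recursion of the central binomial
    coefficients, so [m * beta m ^+ 2] increases and
    [(2 * m + 1) * beta m ^+ 2] decreases. These two monotonicities
    show that [beta m ^+ 2] is of order [1 / m]. *)
Lemma betaS m : (2 * m%:R + 2) * beta m.+1 = (2 * m%:R + 1) * beta m.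
Proof.
rewrite /beta doubleS /= !sub0r !add0r.
have -> : (-1 + 1 : int) = 0 by [].
have -> : (-1 - 1 : int) = - 2 by [].
have -> : (1 - 1 : int) = 0 by [].
have -> : (1 + 1 : int) = 2 by [].
rewrite line_probN.
have := line_prob_rec2 m.*2 0; rewrite add0r rmorph0 subr0 addr0 -muln2 natrM.
nra.
Qed.

Lemma beta0 : beta 0 = 1. Proof. by []. Qed.

Lemma beta_sqrS m :
  (2 * m%:R + 2) ^+ 2 * beta m.+1 ^+ 2 = (2 * m%:R + 1) ^+ 2 * beta m ^+ 2.
Proof. by rewrite -!exprMn betaS. Qed.

Lemma beta_sqr_le m : (2 * m%:R + 1) * beta m ^+ 2 <= 1.
Proof.
elim: m => [|m IH]; first by rewrite beta0; lra.
apply: le_trans IH; have := beta_sqrS m; have : 0 <= m%:R :> R by [].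
rewrite -(natr1 m); set x : R := m%:R; have := sqr_ge0 (beta m).
set b := beta m ^+ 2; set c := beta m.+1 ^+ 2 => b0 x0 H.
have x2 : 0 < (2 * x + 2) ^+ 2 by nra.
rewrite -(ler_pM2l x2) mulrCA H; nra.
Qed.

Lemma beta_sqr_ge m : (0 < m)%N -> 1 / 4 <= m%:R * beta m ^+ 2.
Proof.
elim: m => [//|[|m] IH] _.
  by have := betaS 0; rewrite beta0 => h; rewrite (_ : beta 1 = 1/2); lra.
apply: le_trans (IH isT) _; move: m.+1 => {IH}n.
have := beta_sqrS n; have : 0 <= n%:R :> R by [].
rewrite -(natr1 n); set x : R := n%:R; have := sqr_ge0 (beta n).
set b := beta n ^+ 2; set c := beta n.+1 ^+ 2 => b0 x0 H.
have x2 : 0 < (2 * x + 2) ^+ 2 by nra.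
rewrite -(ler_pM2l x2) (mulrCA _ _ c) H; nra.
Qed.

(** Rewriting the ratio identity as a formula for the increments and summing.
    Bounding every term of the sum by its first, respectively last, value then
    gives both the near-diagonal flatness [line_prob_drop_le] and the
    off-diagonal decay [line_prob_drop_ge]. *)
Lemma line_prob_telescope (k : nat) (n : nat) :
  k%:R * (line_prob k 0 - line_prob k (n.*2)%:Z) =
  \sum_(i < n) ((i.*2)%:R * line_prob k (i.*2)%:Z
                + (i.+1.*2)%:R * line_prob k (i.+1.*2)%:Z).
Proof.
elim: n => [|n IH]; first by rewrite big_ord0 subrr mulr0.
rewrite big_ord_recr /= -IH.
have := line_prob_rec2 k (n.*2)%:Z.
have -> : ((n.*2)%:Z + 2) = (n.+1.*2)%:Z by lia.
rewrite doubleS -!natrD /= .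
have -> : ((n.*2).+2)%:R = (n.*2)%:R + 2 :> R by rewrite -(natrD _ _ 2) addn2.
rewrite -pmulrn. lra.
Qed.

Lemma line_prob_even_le k (i : nat) : line_prob k (i.*2)%:Z <= line_prob k 0.
Proof. by have := line_prob_antimono k i (lexx 0); rewrite add0r. Qed.

Lemma sum_double_odd n :
  \sum_(i < n) ((i.*2)%:R + (i.+1.*2)%:R : R) = 2 * n%:R ^+ 2.
Proof.
elim: n => [|n IH]; first by rewrite big_ord0 expr0n mulr0.
by rewrite big_ord_recr /= IH -!mul2n !natrM -(natr1 n); ring.
Qed.

Lemma line_prob_drop_le k n :
  k%:R * (line_prob k 0 - line_prob k (n.*2)%:Z) <= 2 * n%:R ^+ 2 * line_prob k 0.
Proof.
rewrite line_prob_telescope -sum_double_odd mulr_suml; apply: ler_sum => i _.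
rewrite [leRHS]mulrDl; apply: lerD; rewrite ler_wpM2l ?line_prob_even_le //.
Qed.

Lemma line_prob_drop_ge k n :
  2 * n%:R ^+ 2 * line_prob k (n.*2)%:Z <=
  k%:R * (line_prob k 0 - line_prob k (n.*2)%:Z).
Proof.
rewrite line_prob_telescope -sum_double_odd mulr_suml; apply: ler_sum => i _.
have hi := ltn_ord i.
rewrite [leLHS]mulrDl; apply: lerD; rewrite ler_wpM2l //; apply: line_prob_even_antimono; lia.
Qed.

Lemma line_prob_le_half k u : line_prob k u <= beta k./2.
Proof.
have even_case m v : line_prob m.*2 v <= beta m.
  have [ov|ov] := boolP (odd `|v|%N).
    by rewrite line_prob_parity ?beta_ge0 //; lia.
  by apply: line_prob_even_antimono.
rewrite -{1}(odd_double_half k); case: (odd k); rewrite ?add0n ?add1n //=.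
have := even_case k./2 (u - 1); have := even_case k./2 (u + 1); lra.
Qed.

End LineProb.

(** * The simple random walk on the plane *)

Definition l1norm (x : Z2) : nat := (`|x.1| + `|x.2|)%N.
Arguments l1norm x%_ring_scope.

Section PlaneProb.
Variable R : realType.
Implicit Types (x y : Z2).

Lemma sum_step (f : Z2 -> R) x : \sum_(e < 4) f (x + step e) =
  f (x.1 + 1, x.2) + f (x.1 - 1, x.2) + f (x.1, x.2 + 1) + f (x.1, x.2 - 1).
Proof.
case: x => u v; rewrite !big_ord_recl big_ord0 /step /= addr0 !addrA.
rewrite /GRing.add /=; rewrite /add_pair /=.
by rewrite !addr0.
Qed.

(** Rotating the lattice by 45 degrees turns the planar walk into two
    independent walks on the line. *)
Definition plane_prob (k : nat) x : R :=
  line_prob R k (x.1 + x.2) * line_prob R k (x.1 - x.2).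

Lemma plane_prob_ge0 k x : 0 <= plane_prob k x.
Proof. by rewrite mulr_ge0 ?line_prob_ge0. Qed.

Lemma plane_prob0 x : plane_prob 0 x = (x == 0)%:R.
Proof.
rewrite /plane_prob /= -natrM mulnb; congr (nat_of_bool _)%:R.
by case: x => u v /=; rewrite xpair_eqE; apply/idP/idP; lia.
Qed.

Lemma plane_probS k x :
  plane_prob k.+1 x = (\sum_(e < 4) plane_prob k (x + step e)) / 4.
Proof.
rewrite sum_step /plane_prob /=; case: x => u v /=.
have -> : u + 1 + v = u + v + 1 by lia.
have -> : u - 1 + v = u + v - 1 by lia.
have -> : u + (v + 1) = u + v + 1 by lia.
have -> : u + (v - 1) = u + v - 1 by lia.
have -> : u + 1 - v = u - v + 1 by lia.
have -> : u - 1 - v = u - v - 1 by lia.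
have -> : u - (v + 1) = u - v - 1 by lia.
have -> : u - (v - 1) = u - v + 1 by lia.
by field.
Qed.

Lemma big_ffun_ord_recl (T : finType) k (F : {ffun 'I_k.+1 -> T} -> R) :
  \sum_e F e =
  \sum_t \sum_(e : {ffun 'I_k -> T})
    F [ffun i => if unlift ord0 i is Some j then e j else t].
Proof.
rewrite pair_big /=.
rewrite (reindex (fun p : T * {ffun 'I_k -> T} =>
   [ffun i => if unlift ord0 i is Some j then p.2 j else p.1])) //=.
exists (fun e => (e ord0, [ffun j => e (lift ord0 j)])) => [[t e] _|e _] /=.
  rewrite ffunE unlift_none; congr pair; apply/ffunP => j.
  by rewrite !ffunE liftK.
apply/ffunP => i; rewrite ffunE; case: unliftP => [j ->|->] //.
by rewrite ffunE.
Qed.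

Lemma srw_prob_card k x y : srw_prob R k x y =
  (\sum_(e : {ffun 'I_k -> 'I_4}) (x + \sum_(i < k) step (e i) == y)%:R) / 4 ^+ k.
Proof.
rewrite /srw_prob -sum1_card natr_sum; congr (_ / _).
by rewrite big_mkcond /=; apply: eq_bigr => e _; rewrite inE; case: (_ == y).
Qed.

(** First-step decomposition of the count of step sequences. *)
Lemma srw_probS k x y :
  srw_prob R k.+1 x y = (\sum_(t < 4) srw_prob R k (x + step t) y) / 4.
Proof.
under eq_bigr do rewrite srw_prob_card.
rewrite -mulr_suml srw_prob_card big_ffun_ord_recl exprS invfM mulrAC -!mulrA.
congr (_ * _); apply: eq_bigr => t _; apply: eq_bigr => e _.
rewrite big_ord_recl ffunE unlift_none addrA; congr (_ + _ == _)%:R.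
by apply: eq_bigr => i _; rewrite ffunE liftK.
Qed.

Lemma srw_probE k x : srw_prob R k x 0 = plane_prob k x.
Proof.
elim: k x => [|k IH] x.
  rewrite srw_prob_card expr0 divr1 plane_prob0.
  under eq_bigr do rewrite big_ord0 addr0.
  by rewrite sumr_const card_ffun !card_ord expn0.
rewrite srw_probS plane_probS; congr (_ / _).
by apply: eq_bigr => t _; rewrite IH.
Qed.

Lemma l1norm_eq0 x : (l1norm x == 0%N) = (x == 0).
Proof. by case: x => u v; rewrite /l1norm xpair_eqE /=; lia. Qed.

Lemma plane_prob_parity k x : odd (k + l1norm x) -> plane_prob k x = 0.
Proof.
by move=> h; rewrite /plane_prob line_prob_parity ?mul0r //; move: h; rewrite /l1norm; lia.
Qed.

Lemma plane_prob00 k : plane_prob k.*2 0 = beta R k ^+ 2.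
Proof. exact: esym (expr2 _). Qed.

Lemma plane_prob_le k x : plane_prob k.+1 x <= k.+1%:R^-1.
Proof.
rewrite -[_^-1]mul1r ler_pdivlMr ?ltr0n // mulrC.
have h1 : plane_prob k.+1 x <= beta R k.+1./2 ^+ 2.
  by rewrite expr2 ler_pM ?line_prob_ge0 ?line_prob_le_half.
apply: le_trans (beta_sqr_le R k.+1./2).
apply: le_trans (ler_wpM2l (ler0n _ _) h1) _.
rewrite ler_wpM2r ?sqr_ge0 // -[X in _ + X]/(1%:R) -natrM -natrD ler_nat; lia.
Qed.

End PlaneProb.

(** * The potential kernel and its logarithmic growth *)

Section PotentialKernel.
Variable R : realType.
Implicit Types (x y : Z2).

(** The expected number of visits to the origin before time [2 * r ^ 2];
    it is the explicit substitute for the logarithm of [r]. *)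
Definition psi (r : nat) : R := \sum_(m < r ^ 2) beta R m ^+ 2.

Lemma psi_mono : {homo psi : r s / (r <= s)%N >-> r <= s}.
Proof.
move=> r s rs; rewrite /psi -!(big_mkord xpredT (fun m => beta R m ^+ 2)).
have rs2 : (r ^ 2 <= s ^ 2)%N by rewrite leq_exp2r.
by rewrite [leRHS](big_cat_nat _ rs2) //= lerDl sumr_ge0 // => i _; rewrite sqr_ge0.
Qed.

Lemma psiS_le r : psi r.+1 <= psi r + 1.
Proof.
rewrite /psi -!(big_mkord xpredT (fun m => beta R m ^+ 2)).
have rs2 : (r ^ 2 <= r.+1 ^ 2)%N by rewrite leq_exp2r.
rewrite [leLHS](big_cat_nat _ rs2) //= lerD2l.
case: r rs2 => [|r] rs2.
  by rewrite big_nat1 beta0 expr1n.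
apply: le_trans (_ : \sum_(r.+1 ^ 2 <= i < r.+2 ^ 2) (2 * r.+1%:R ^+ 2 + 1)^-1 <= _).
  apply: ler_sum_nat => i /andP[h _].
  rewrite -[leRHS]mul1r ler_pdivlMr; last by have := sqr_ge0 (r.+1%:R : R); lra.
  rewrite mulrC; apply: le_trans (beta_sqr_le R i).
  rewrite ler_wpM2r ?sqr_ge0 // lerD2r ler_wpM2l // -natrX ler_nat //.
rewrite big_const_nat iter_addr_0 -[leLHS]mulr_natl ler_pdivrMr; last first.
  by have := sqr_ge0 (r.+1%:R : R); lra.
rewrite mul1r -natrX -natrM natr1 ler_nat. lia.
Qed.

(** The summands are of order [1 / m], so each doubling of the radius
    contributes an amount bounded above and below. *)
Lemma psi_double r : (0 < r)%N ->
  psi r + 3 / 16 <= psi (2 * r) <= psi r + 3 / 2.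
Proof.
move=> r0; rewrite /psi -!(big_mkord xpredT (fun m => beta R m ^+ 2)).
have rs2 : (r ^ 2 <= (2 * r) ^ 2)%N by rewrite leq_exp2r // leq_pmull.
have rp : 0 < r%:R ^+ 2 :> R by rewrite exprn_gt0 // ltr0n.
have e3 : ((2 * r) ^ 2 - r ^ 2)%:R = 3 * r%:R ^+ 2 :> R.
  by rewrite -natrX -natrM; congr _%:R; lia.
rewrite (big_cat_nat _ rs2) //= !lerD2l; apply/andP; split.
  apply: le_trans (_ : \sum_(r ^ 2 <= i < (2 * r) ^ 2) (16 * r%:R ^+ 2)^-1 <= _).
    rewrite big_const_nat iter_addr_0 -[leRHS]mulr_natl e3.
    by rewrite ler_pdivlMr; lra.
  apply: ler_sum_nat => i /andP[h1 h2].
  rewrite -[leLHS]mul1r ler_pdivrMr; last by lra.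
  have i0 : (0 < i)%N by apply: leq_trans h1; rewrite expn_gt0 r0.
  have := beta_sqr_ge R i0.
  have : i%:R <= 4 * r%:R ^+ 2 :> R by rewrite -natrX -natrM ler_nat; lia.
  have := sqr_ge0 (beta R i); nra.
apply: le_trans (_ : \sum_(r ^ 2 <= i < (2 * r) ^ 2) (2 * r%:R ^+ 2)^-1 <= _).
  apply: ler_sum_nat => i /andP[h _].
  rewrite -[leRHS]mul1r ler_pdivlMr; last by lra.
  have := beta_sqr_le R i.
  have : r%:R ^+ 2 <= i%:R :> R by rewrite -natrX ler_nat.
  have := sqr_ge0 (beta R i); nra.
rewrite big_const_nat iter_addr_0 -[leLHS]mulr_natl e3 ler_pdivrMr; lra.
Qed.

Definition kernel_term x (k : nat) : R := plane_prob R k 0 - plane_prob R k x.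

Lemma potential_kernelE x : potential_kernel R x = limn (series (kernel_term x)).
Proof.
rewrite /potential_kernel; congr (limn (series _)); apply/funext => k.
by rewrite !srw_probE.
Qed.

Lemma kernel_term_odd x m : ~~ odd (l1norm x) -> kernel_term x m.*2.+1 = 0.
Proof.
move=> ex; rewrite /kernel_term !plane_prob_parity ?subrr //.
- by move: ex; lia.
- by rewrite /l1norm /=; lia.
Qed.

Lemma kernel_term_ge0 x k : ~~ odd (l1norm x) -> 0 <= kernel_term x k.
Proof.
move=> ex; rewrite -(odd_double_half k); case: (odd k); rewrite ?add1n ?add0n.
  by rewrite kernel_term_odd.
rewrite subr_ge0 plane_prob00 expr2 /plane_prob ler_pM ?line_prob_ge0 //;
  apply: line_prob_even_antimono => //; move: ex; rewrite /l1norm; lia.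
Qed.

Lemma series_kernel_even x n : ~~ odd (l1norm x) ->
  series (kernel_term x) n.*2 = \sum_(m < n) kernel_term x m.*2.
Proof.
move=> ex; rewrite /series /= -(big_mkord xpredT (fun m => kernel_term x m.*2)).
elim: n => [|n IH]; first by rewrite !big_geq.
rewrite doubleS !big_nat_recr //= IH kernel_term_odd // addr0 //.
Qed.

(** One of the two rotated coordinates has absolute value exactly [l1norm x].
    *)
Lemma plane_prob_even_le x m : ~~ odd (l1norm x) ->
  plane_prob R m.*2 x <= beta R m * line_prob R m.*2 (l1norm x)%:Z.
Proof.
move=> ex; rewrite /plane_prob.
have [h|h] := leP `|x.1 - x.2|%R `|x.1 + x.2|%R.
  have e : l1norm x = absz (x.1 + x.2) by rewrite /l1norm; lia.
  rewrite e line_prob_absz mulrC ler_wpM2r ?line_prob_ge0 //.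
  by apply: line_prob_even_antimono => //; move: ex; rewrite /l1norm; lia.
have e : l1norm x = absz (x.1 - x.2) by rewrite /l1norm; lia.
rewrite e line_prob_absz ler_wpM2r ?line_prob_ge0 //.
by apply: line_prob_even_antimono => //; move: ex; rewrite /l1norm; lia.
Qed.

Lemma plane_prob_even_ge x m : ~~ odd (l1norm x) ->
  line_prob R m.*2 (l1norm x)%:Z ^+ 2 <= plane_prob R m.*2 x.
Proof.
move=> ex; rewrite /plane_prob expr2 ler_pM ?line_prob_ge0 //;
  apply: line_prob_even_antimono => //; move: ex; rewrite /l1norm; lia.
Qed.

(** The decay [N ^ 2 / m ^ 2] of the terms beyond the diffusive time is
    written in a form that telescopes. *)
Lemma kernel_term_le x m : ~~ odd (l1norm x) -> (0 < m)%N ->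
  kernel_term x m.*2 <= (l1norm x)%:R ^+ 2 / 2 * (m%:R^-1 - m.+1%:R^-1).
Proof.
move=> ex m0; rewrite /kernel_term plane_prob00.
have := plane_prob_even_ge m ex.
have [n en] : exists n, l1norm x = n.*2.
  by exists (l1norm x)./2; rewrite even_halfK.
have := line_prob_drop_le R m.*2 n; have := line_prob_even_le R m.*2 n.
have := line_prob_ge0 R m.*2 (n.*2)%:Z.
have := beta_sqr_le R m; have := beta_ge0 R m.
rewrite -/(beta R m) en; set b := beta R m; set q := line_prob _ _ _.
move: (plane_prob R m.*2 x) => p.
rewrite -(natr1 m) -!mul2n !natrM; have : 1 <= m%:R :> R by rewrite ler1n.
set M : R := m%:R; set N : R := n%:R => M1 b0 b1 q0 qb h1 h2 {en}.
have -> : (2 * N) ^+ 2 / 2 * (M^-1 - (M + 1)^-1) = 2 * N ^+ 2 / (M * (M + 1)).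
  by field; lra.
rewrite ler_pdivlMr; last by nra.
have N2 := sqr_ge0 N.
have h3 : (b ^+ 2 - p) * M <= 2 * N ^+ 2 * b ^+ 2.
  have : (b ^+ 2 - p) <= 2 * b * (b - q) by nra.
  nra.
have h4 : b ^+ 2 * (M + 1) <= 1 by have := sqr_ge0 b; nra.
nra.
Qed.

(** The time axis is cut at the diffusive time [N ^ 2], [N] being the norm
    of the point: before it, each term is at most a return probability; after
    it, the terms sum to a constant. *)
Lemma series_kernel_le x n : ~~ odd (l1norm x) ->
  series (kernel_term x) n <= psi (l1norm x) + 1 / 2.
Proof.
move=> ex.
have [x0|/eqP x0] := eqVneq x 0.
  have -> : series (kernel_term x) n = 0.
    by rewrite x0 /series /=; apply: big1 => i _; rewrite /kernel_term subrr.
  have -> : l1norm x = 0%N by rewrite x0.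
  by rewrite /psi big_ord0 add0r divr_ge0.
have N0 : (0 < l1norm x)%N by rewrite lt0n l1norm_eq0; apply/eqP.
set N := l1norm x in ex N0 *.
have hm : nondecreasing_seq (series (kernel_term x)).
  by apply/nondecreasing_series => k _ _; exact: kernel_term_ge0.
apply: le_trans (_ : series (kernel_term x) (N ^ 2 + n).*2 <= _).
  by apply: hm; rewrite -addnn; exact: leq_trans (leq_addl (N ^ 2) n) (leq_addr _ _).
rewrite series_kernel_even // -(big_mkord xpredT (fun m => kernel_term x m.*2)).
rewrite (@big_cat_nat _ _ _ (N ^ 2)) //= ?leq_addr //; apply: lerD.
  rewrite big_mkord; apply: ler_sum => i _.
  by rewrite /kernel_term plane_prob00 gerBl plane_prob_ge0.
apply: le_trans (_ : \sum_(N ^ 2 <= i < N ^ 2 + n)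
    (N%:R ^+ 2 / 2 * (i%:R^-1 - i.+1%:R^-1)) <= _).
  apply: ler_sum_nat => i /andP[hi _]; apply: kernel_term_le => //.
  by apply: leq_trans hi; rewrite expn_gt0 N0.
rewrite -mulr_sumr (@telescope_sumr_eq _ _ _ (fun i => - i%:R^-1)) ?leq_addr //; last first.
  by move=> k _; rewrite opprK addrC.
rewrite opprK natrX.
have s0 : 0 < N%:R ^+ 2 :> R by rewrite exprn_gt0 // ltr0n.
have : 0 <= (N ^ 2 + n)%:R^-1 :> R by rewrite invr_ge0.
move: (_^-1) => t t0.
have e : N%:R ^+ 2 / 2 * (N%:R ^+ 2)^-1 = 1 / 2 :> R by field; rewrite pnatr_eq0 -lt0n.
rewrite mulrDr e; nra.
Qed.

(** Up to time [N ^ 2] the walk started at distance [N] is expected to visit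
    the origin a bounded number of times, because [p_m] is at most of order
    [1 / N ^ 2] there. *)
Lemma series_kernel_ge x : ~~ odd (l1norm x) ->
  psi (l1norm x) - 2 <= series (kernel_term x) (l1norm x ^ 2).*2.
Proof.
move=> ex; rewrite series_kernel_even // /psi /kernel_term.
rewrite [leRHS]sumrB; under [X in _ <= X - _]eq_bigr do rewrite plane_prob00.
rewrite lerD2l lerN2.
have [->|N0] := posnP (l1norm x); first by rewrite big_ord0.
have Np : 0 < (l1norm x)%:R :> R by rewrite ltr0n.
apply: le_trans (_ : \sum_(i < l1norm x ^ 2) 2 / (l1norm x)%:R ^+ 2 <= _); last first.
  by rewrite sumr_const card_ord -[leLHS]mulr_natl natrX mulrCA divff ?mulr1 // sqrf_eq0 lt0r_neq0.
apply: ler_sum => -[m /= _] _; rewrite ler_pdivlMr ?exprn_gt0 //.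
apply: le_trans (ler_wpM2r (sqr_ge0 _) (plane_prob_even_le m ex)) _.
have [n en] : exists n, l1norm x = n.*2.
  by exists (l1norm x)./2; rewrite even_halfK.
have := line_prob_drop_ge R m.*2 n; have := line_prob_ge0 R m.*2 (n.*2)%:Z.
have := beta_sqr_le R m; have := beta_ge0 R m.
rewrite -/(beta R m) en; set b := beta R m; set q := line_prob _ _ _.
rewrite -!mul2n !natrM; have : 0 <= m%:R :> R by [].
set M : R := m%:R; set N : R := n%:R => M0 b0 b1 q0 h {en}.
have N2 := sqr_ge0 N.
have : 2 * N ^+ 2 * q <= 2 * M * b by nra.
have := sqr_ge0 b; nra.
Qed.

Lemma kernel_even_cvg x : ~~ odd (l1norm x) -> cvgn (series (kernel_term x)).
Proof.
move=> ex; apply: nondecreasing_is_cvgn.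
  by apply/nondecreasing_series => k _ _; exact: kernel_term_ge0.
by exists (psi (l1norm x) + 1 / 2) => _ [n _ <-]; exact: series_kernel_le.
Qed.

Lemma series_kernel_le_lim x n : ~~ odd (l1norm x) ->
  series (kernel_term x) n <= potential_kernel R x.
Proof.
move=> ex; rewrite potential_kernelE; apply: nondecreasing_cvgn_le.
  by apply/nondecreasing_series => k _ _; exact: kernel_term_ge0.
exact: kernel_even_cvg.
Qed.

Lemma potential_kernel_even_bounds x : ~~ odd (l1norm x) ->
  psi (l1norm x) - 2 <= potential_kernel R x <= psi (l1norm x) + 1 / 2.
Proof.
move=> ex; apply/andP; split.
  exact: le_trans (series_kernel_ge ex) (series_kernel_le_lim _ ex).
rewrite potential_kernelE; apply: limr_le; first exact: kernel_even_cvg.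
by apply: nearW => n; exact: series_kernel_le.
Qed.

(** Summing by parts over one step of the walk shows that the partial sums are
    already harmonic up to the probability of being at the origin at the last
    time. *)
Lemma series_kernel_rec x n : series (kernel_term x) n =
  (\sum_(e < 4) series (kernel_term (x + step e)) n) / 4
    - (x == 0)%:R + plane_prob R n x.
Proof.
rewrite /series /= exchange_big /=.
elim: n => [|n IH].
  by rewrite !big_geq // mul0r sub0r plane_prob0 addNr.
rewrite !big_nat_recr //= IH plane_probS /kernel_term sumrB sumr_const card_ord.
by rewrite -[_ *+ 4]mulr_natl; field.
Qed.

Lemma odd_l1norm_step x e : odd (l1norm (x + step e)) = ~~ odd (l1norm x).
Proof.
case: x => u v; case: e => -[|[|[|[|//]]]] he; rewrite /step /l1norm /=; lia.
Qed.

Lemma plane_prob_cvg0 x : plane_prob R n x @[n --> \oo] --> (0 : R).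
Proof.
rewrite -cvg_shiftS; apply: (@squeeze_cvgr _ _ _ _ (cst 0) harmonic).
- by apply: nearW => n /=; rewrite plane_prob_ge0 plane_prob_le.
- exact: cvg_cst.
- exact: cvg_harmonic.
Qed.

Lemma cvg_sum (I : Type) (r : seq I) (f : I -> nat -> R) (l : I -> R) :
  (forall i, f i n @[n --> \oo] --> l i) ->
  \sum_(i <- r) f i n @[n --> \oo] --> \sum_(i <- r) l i.
Proof.
move=> fl; elim: r => [|i r IH].
  by rewrite big_nil; under eq_fun do rewrite big_nil; exact: cvg_cst.
by rewrite big_cons; under eq_fun do rewrite big_cons; exact: cvgD.
Qed.

(** For points of odd parity the terms alternate in sign; [series_kernel_rec]
    reduces their convergence to that at the even neighbours. *)
Lemma series_kernel_cvg x : cvgn (series (kernel_term x)).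
Proof.
have [ox|ex] := boolP (odd (l1norm x)); last exact: kernel_even_cvg.
rewrite (_ : series _ = fun n => (\sum_(e < 4) series (kernel_term (x + step e)) n) / 4
    - (x == 0)%:R + plane_prob R n x); last by apply/funext => n; exact: series_kernel_rec.
apply: is_cvgD; last by apply/cvg_ex; exists 0; exact: plane_prob_cvg0.
apply: is_cvgB; last exact: is_cvg_cst.
apply: is_cvgM; last exact: is_cvg_cst.
apply/cvg_ex; exists (\sum_(e < 4) limn (series (kernel_term (x + step e)))).
by apply: cvg_sum => e; apply: kernel_even_cvg; rewrite odd_l1norm_step ox.
Qed.

Lemma potential_kernel_avg x :
  potential_kernel R x = (\sum_(e < 4) potential_kernel R (x + step e)) / 4 - (x == 0)%:R.
Proof.
rewrite [LHS]potential_kernelE; apply/cvg_lim => //.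
rewrite -[X in _ --> X]addr0.
rewrite (_ : series _ = fun n => (\sum_(e < 4) series (kernel_term (x + step e)) n) / 4
    - (x == 0)%:R + plane_prob R n x); last by apply/funext => n; exact: series_kernel_rec.
apply: cvgD; last exact: plane_prob_cvg0.
apply: cvgB; last exact: cvg_cst.
apply: cvgM; last exact: cvg_cst.
apply: cvg_sum => e; rewrite potential_kernelE; exact: series_kernel_cvg.
Qed.

Lemma potential_kernel0 : potential_kernel R 0 = 0.
Proof.
rewrite potential_kernelE (_ : series _ = cst 0) ?lim_cst //.
apply/funext => n; rewrite /series /= big1 // => i _.
by rewrite /kernel_term subrr.
Qed.

Lemma potential_kernel_harmonic x : x != 0 ->
  \sum_(e < 4) potential_kernel R (x + step e) = 4 * potential_kernel R x.
Proof.
by move=> /negbTE x0; rewrite [in RHS]potential_kernel_avg x0 subr0 mulrCA divff ?mulr1.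
Qed.

Lemma potential_kernel_even_ge1 x : x != 0 -> ~~ odd (l1norm x) ->
  1 <= potential_kernel R x.
Proof.
move=> x0 ex; apply: le_trans (series_kernel_le_lim 1 ex).
by rewrite /series /= big_nat1 /kernel_term !plane_prob0 eqxx (negbTE x0) subr0.
Qed.

Lemma potential_kernel_ge x : x != 0 -> 3 / 4 <= potential_kernel R x.
Proof.
move=> x0; have [ox|ex] := boolP (odd (l1norm x)); last first.
  by have := potential_kernel_even_ge1 x0 ex; lra.
rewrite potential_kernel_avg (negbTE x0) subr0 ler_pM2r //.
have step_ge e : (x + step e != 0)%:R <= potential_kernel R (x + step e).
  have [->|h] := eqVneq (x + step e) 0; first by rewrite potential_kernel0.
  by apply: potential_kernel_even_ge1 => //; rewrite odd_l1norm_step ox.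
apply: le_trans (ler_sum _ (fun e _ => step_ge e)).
rewrite (@sum_step R (fun y => (y != 0)%:R)) -!natrD ler_nat.
by case: x {ox step_ge} x0 => u v; rewrite !xpair_eqE /=; lia.
Qed.

(** The only asymptotic information about the potential kernel that the proof
    uses: it differs from an explicit radial function by a bounded amount. *)
Lemma potential_kernel_bounds x :
  psi (l1norm x) - 3 <= potential_kernel R x <= psi (l1norm x) + 3.
Proof.
have [ox|ex] := boolP (odd (l1norm x)); last first.
  by have := potential_kernel_even_bounds ex; lra.
have x0 : x != 0 by apply: contraTneq ox => ->.
rewrite potential_kernel_avg (negbTE x0) subr0.
have step_bounds e : psi (l1norm x) - 3 <= potential_kernel R (x + step e)
    <= psi (l1norm x) + 3.
  have : ~~ odd (l1norm (x + step e)) by rewrite odd_l1norm_step ox.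
  move=> /potential_kernel_even_bounds.
  have [n en] : exists n, l1norm x = n.+1.
    by case: (l1norm x) ox => // n _; exists n.
  have h1 : (l1norm (x + step e) <= n.+2)%N.
    rewrite -en; case: x {ox x0 en} => u v.
    case: e => -[|[|[|[|//]]]] he; rewrite /step /l1norm /=; lia.
  have h2 : (n <= l1norm (x + step e))%N.
    rewrite -ltnS -en; case: x {ox x0 en h1} => u v.
    case: e => -[|[|[|[|//]]]] he; rewrite /step /l1norm /=; lia.
  have := psi_mono h1; have := psi_mono h2; rewrite en.
  have := psiS_le n; have := psiS_le n.+1; lra.
have sum4 (c : R) : \sum_(e < 4) c = c * 4.
  by rewrite sumr_const card_ord mulr_natr.
rewrite ler_pdivlMr // ler_pdivrMr // -!sum4; apply/andP; split;
  by apply: ler_sum => e _; case/andP: (step_bounds e).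
Qed.

End PotentialKernel.

(** * Dyadic levels and the walk killed at the origin *)

Section Scales.
Variable R : realType.
Implicit Types (x y : Z2).
Local Notation a := (potential_kernel R).

Lemma l1normN x : l1norm (- x) = l1norm x.
Proof. by case: x => u v; rewrite /l1norm /=; lia. Qed.

Lemma l1normD x y : (l1norm (x + y) <= l1norm x + l1norm y)%N.
Proof. by case: x y => [u v] [u' v']; rewrite /l1norm /=; lia. Qed.

Lemma l1normB x y : (l1norm (x - y) <= l1norm x + l1norm y)%N.
Proof. by rewrite -(l1normN y) l1normD. Qed.

Lemma l1norm_triangle y x z : (l1norm (x - z) <= l1norm (x - y) + l1norm (y - z))%N.
Proof. by have := l1normD (x - y) (y - z); rewrite addrA subrK. Qed.

Lemma l1norm_sub_le y x : (l1norm y <= l1norm x + l1norm (x - y))%N.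
Proof. by have := l1normB x (x - y); rewrite opprB addrC subrK. Qed.

Lemma l1norm_le_sub y x : (l1norm x <= l1norm (x - y) + l1norm y)%N.
Proof. by have := l1normD (x - y) y; rewrite subrK. Qed.

Lemma l1norm_step (e : 'I_4) : l1norm (step e) = 1%N.
Proof. by case: e => -[|[|[|[|//]]]]. Qed.

Lemma l1norm_stepD x e : (l1norm (x + step e) <= (l1norm x).+1)%N.
Proof. by rewrite -addn1 -(l1norm_step e) l1normD. Qed.

Lemma l1norm_stepD_ge x e : (l1norm x <= (l1norm (x + step e)).+1)%N.
Proof. by have := l1normB (x + step e) (step e); rewrite addrK l1norm_step addn1. Qed.

(** The approximate value of the potential kernel at distance [2 ^ i]. All
    radii below are powers of two, so that every comparison of values of the
    kernel becomes a comparison of exponents. *)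
Definition level (i : nat) : R := psi R (2 ^ i).

Lemma level_bounds i j :
  level i + 3 / 16 * j%:R <= level (i + j) <= level i + 3 / 2 * j%:R.
Proof.
elim: j => [|j IH]; first by rewrite addn0 !mulr0 !addr0 lexx.
have := @psi_double R (2 ^ (i + j)); rewrite expn_gt0 -expnS -addnS => /(_ isT).
rewrite -/(level (i + j)) -/(level (i + j.+1)) -(natr1 j); lra.
Qed.

Lemma level_diff_ge i j : (i <= j)%N -> level i + 3 / 16 * (j%:R - i%:R) <= level j.
Proof. by move=> ij; have := level_bounds i (j - i); rewrite subnKC // natrB //; case/andP. Qed.

Lemma level_diff_le i j : (i <= j)%N -> level j <= level i + 3 / 2 * (j%:R - i%:R).
Proof. by move=> ij; have := level_bounds i (j - i); rewrite subnKC // natrB //; case/andP. Qed.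

Lemma level_mono i j : (i <= j)%N -> level i <= level j.
Proof. by move=> ij; apply: psi_mono; rewrite leq_exp2l. Qed.

Lemma level0 : level 0 = 1.
Proof. by rewrite /level /psi big_ord1 beta0 expr1n. Qed.

Lemma level_ge i : 1 + 3 / 16 * i%:R <= level i.
Proof. by have := level_bounds 0 i; rewrite level0; case/andP. Qed.

Lemma level_le i : level i <= 1 + 3 / 2 * i%:R.
Proof. by have := level_bounds 0 i; rewrite level0; case/andP. Qed.

Lemma kernel_ge_level i x : (2 ^ i <= l1norm x)%N -> level i - 3 <= a x.
Proof.
by move=> h; have := psi_mono R h; have := potential_kernel_bounds R x; rewrite /level; lra.
Qed.

Lemma kernel_le_level i x : (l1norm x <= 2 ^ i)%N -> a x <= level i + 3.
Proof.
by move=> h; have := psi_mono R h; have := potential_kernel_bounds R x; rewrite /level; lra.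
Qed.

Lemma kernel_ge0 x : 0 <= a x.
Proof.
have [->|x0] := eqVneq x 0; first by rewrite potential_kernel0.
by have := potential_kernel_ge R x0; lra.
Qed.

End Scales.

Notation current h := (head (0 : Z2)%R h).

Section WalkSum.
Variable R : realType.
Implicit Types (x y : Z2) (f g : Z2 -> R) (u v : seq Z2 -> R) (h : seq Z2).
Local Notation a := (potential_kernel R).

(** One step of the simple random walk, with the value 0 at the origin: the
    walk dies there. *)
Definition killed_mean f x : R :=
  (\sum_(e < 4) if x + step e == 0 then 0 else f (x + step e)) / 4.

Lemma ler_killed_mean f g x :
  (forall e : 'I_4, x + step e != 0 -> f (x + step e) <= g (x + step e)) ->
  killed_mean f x <= killed_mean g x.
Proof.
by move=> fg; rewrite ler_pM2r //; apply: ler_sum => e _; case: ifPn => // /fg.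
Qed.

(** Killing only discards the value at the origin, which does not help a
    function that is nonpositive there. *)
Lemma killed_mean_sub f x : \sum_(e < 4) f (x + step e) = 4 * f x -> f 0 <= 0 ->
  f x <= killed_mean f x.
Proof.
move=> fx f0; rewrite ler_pdivlMr // mulrC -fx; apply: ler_sum => e _.
by case: eqP => [->|].
Qed.

Lemma killed_mean_super f x : \sum_(e < 4) f (x + step e) = 4 * f x ->
  (0 <= f 0) || (2 <= l1norm x)%N -> killed_mean f x <= f x.
Proof.
move=> fx x2; rewrite ler_pdivrMr // mulrC -fx; apply: ler_sum => e _.
case: eqP => [y0|//]; rewrite y0; case/orP: x2 => // x2.
by have := l1norm_stepD_ge x e; rewrite y0; move=> /(leq_trans x2).
Qed.

(** The expectation of [u] after [N] further steps of the walk killed at the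
    origin. Here [u] depends on the whole past, listed with the newest
    position first, so that events spread over time need no separate state
    space. *)
Fixpoint walk_sum (N : nat) u h : R :=
  if N is N'.+1 then killed_mean (fun y => walk_sum N' u (y :: h)) (current h)
  else u h.

Lemma walk_sumD N u v h :
  walk_sum N (fun h => u h + v h) h = walk_sum N u h + walk_sum N v h.
Proof.
elim: N h => [//|N IH] h /=.
rewrite /killed_mean -mulrDl -big_split /=; congr (_ / _); apply: eq_bigr => e _.
by case: ifP => _; rewrite ?addr0 // IH.
Qed.

Lemma walk_sumZ N c u h :
  walk_sum N (fun h => c * u h) h = c * walk_sum N u h.
Proof.
elim: N h => [//|N IH] h /=.
rewrite /killed_mean mulrA mulr_sumr; congr (_ / _); apply: eq_bigr => e _.
by case: ifP => _; rewrite ?mulr0 // IH.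
Qed.

Lemma walk_sum_sum N (I : Type) (r : seq I) (P : pred I) (u : I -> seq Z2 -> R) h :
  walk_sum N (fun h => \sum_(i <- r | P i) u i h) h =
  \sum_(i <- r | P i) walk_sum N (u i) h.
Proof.
elim: r => [|i r IH].
  rewrite big_nil; under eq_fun do rewrite big_nil.
  elim: N h => [//|N IH] h /=; rewrite /killed_mean big1 ?mul0r // => e _.
  by rewrite IH if_same.
rewrite big_cons; under eq_fun do rewrite big_cons.
case: (P i) => //; rewrite walk_sumD IH //.
Qed.

Definition step_closed (I : seq Z2 -> Prop) := forall h (e : 'I_4),
  I h -> current h + step e != 0 -> I (current h + step e :: h).

Lemma ler_walk_sum (I : seq Z2 -> Prop) N u v h : step_closed I ->
  (forall h, I h -> u h <= v h) -> I h -> walk_sum N u h <= walk_sum N v h.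
Proof.
move=> Icl uv; elim: N h => [|N IH] h Ih /=; first exact: uv.
by apply: ler_killed_mean => e y0; apply: IH; exact: Icl.
Qed.

Lemma ler_walk_sumT N u v h :
  (forall h, u h <= v h) -> walk_sum N u h <= walk_sum N v h.
Proof. by move=> uv; apply: (@ler_walk_sum (fun _ => True)). Qed.

Lemma walk_sum_sub (I : seq Z2 -> Prop) N u h : step_closed I ->
  (forall h, I h -> u h <= killed_mean (fun y => u (y :: h)) (current h)) ->
  I h -> u h <= walk_sum N u h.
Proof.
move=> Icl usub; elim: N h => [//|N IH] h Ih /=.
apply: le_trans (usub _ Ih) _; apply: ler_killed_mean => e y0; apply: IH; exact: Icl.
Qed.

Lemma walk_sum_super (I : seq Z2 -> Prop) N u h : step_closed I ->
  (forall h, I h -> killed_mean (fun y => u (y :: h)) (current h) <= u h) ->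
  I h -> walk_sum N u h <= u h.
Proof.
move=> Icl usub; elim: N h => [//|N IH] h Ih /=.
apply: le_trans _ (usub _ Ih); apply: ler_killed_mean => e y0; apply: IH; exact: Icl.
Qed.

(** Forgetting the killing at the origin leaves the transition probability of
    the free walk. *)
Lemma walk_sum_point N y h :
  walk_sum N (fun h => (current h == y)%:R) h <= plane_prob R N (current h - y).
Proof.
elim: N h => [|N IH] h /=; first by rewrite plane_prob0 subr_eq0.
rewrite plane_probS ler_pM2r //; apply: ler_sum => e _.
case: ifP => _; first exact: plane_prob_ge0.
by rewrite (addrAC _ (- y)); exact: IH.
Qed.

(** Since the potential kernel is bounded on balls, this decay says that the
    conditioned walk leaves every ball. *)
Lemma walk_sum_ball r N h :
  walk_sum N.+1 (fun h => (l1norm (current h) <= r)%N%:R) h <=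
    (2 * r + 1)%:R ^+ 2 / N.+1%:R.
Proof.
pose pt (i j : nat) : Z2 := (i%:Z - r%:Z, j%:Z - r%:Z).
apply: le_trans (_ : walk_sum N.+1 (fun h => \sum_(i < 2 * r + 1) \sum_(j < 2 * r + 1)
    (current h == pt i j)%:R) h <= _).
  apply: ler_walk_sumT => h'; move: (current h') => [x1 x2].
  case: leqP => hr; last by rewrite sumr_ge0 // => i _; rewrite sumr_ge0.
  rewrite /l1norm /= in hr.
  have hi : (absz (x1 + r%:Z)%R < 2 * r + 1)%N by lia.
  have hj : (absz (x2 + r%:Z)%R < 2 * r + 1)%N by lia.
  rewrite (bigD1 (Ordinal hi)) //= (bigD1 (Ordinal hj)) //=.
  rewrite (_ : (x1, x2) == _); last by apply/eqP; rewrite /pt; congr pair; lia.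
  by rewrite -addrA lerDl addr_ge0 // sumr_ge0 // => i _; rewrite sumr_ge0.
rewrite walk_sum_sum.
apply: le_trans (_ : \sum_(i < 2 * r + 1) \sum_(j < 2 * r + 1) N.+1%:R^-1 <= _).
  apply: ler_sum => i _; rewrite walk_sum_sum; apply: ler_sum => j _.
  exact: le_trans (walk_sum_point _ _ _) (plane_prob_le _ _ _).
by rewrite !sumr_const !card_ord -mulrnA -[leLHS]mulr_natl natrM expr2.
Qed.

End WalkSum.

(** * Corridors *)

Section Corridor.
Variables (k M l B : nat) (Y : nat -> Z2).
Implicit Types (x y : Z2) (h : seq Z2).

(** A chain of centres [Y 0, ..., Y M.-1] at scale [2 ^ k], leading from
    the vicinity of the origin to distance [2 ^ (k + l + 39)] in a
    number [M] of steps that is the same for all scales. The gap of 39 octaves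
    makes the gain of the potential kernel from [2 ^ (k + l)] to the end
    of the chain exceed the error terms; [2 ^ (k + B)] bounds the regions
    of all stages but the last. *)
Record corridor : Prop := Corridor {
  corridor_nonempty : (0 < M)%N;
  corridor_start : (l1norm (Y 0) <= 2 ^ (k + 4))%N;
  corridor_away : forall i, (i < M)%N -> (2 ^ (k + 2) <= l1norm (Y i))%N;
  corridor_bounded : forall i, (i < M)%N ->
    (l1norm (Y i) + 2 ^ (k + 48) < 2 ^ (k + B))%N;
  corridor_step : forall i, (i.+1 < M)%N ->
    (l1norm (Y i - Y i.+1) <= 2 ^ (k + 1))%N;
  corridor_end : (2 ^ (k + l + 39) <= l1norm (Y M.-1))%N }.

(** Stage 0 is the initial wandering, stage [j.+1] the trip to the centre
    [Y j], and any stage after the last centre the final escape, during which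
    a ball must not be revisited. *)
Definition region (i : nat) x : bool :=
  if i is j.+1 then
    if (j < M)%N then (l1norm (x - Y j) <= 2 ^ (k + 48))%N
    else (2 ^ (k + l) < l1norm x)%N
  else (l1norm x <= 2 ^ (k + 2))%N.

(** Hitting the target of a stage starts the next one. The upper bound at
    stage 0 makes the region of stage 1 contain this target. *)
Definition target (i : nat) x : bool :=
  if i is j.+1 then (j < M)%N && (l1norm (x - Y j) <= 2 ^ k)%N
  else (2 ^ (k + 2) < l1norm x <= 2 ^ (k + 3))%N.

(** [None] stands for failure, which is final. *)
Definition advance (q : option nat) x : option nat :=
  if q is Some i then
    if target i x then Some i.+1 else if region i x then Some i else None
  else None.

Definition stage h : option nat := foldr (fun x q => advance q x) (Some 0%N) h.

Lemma expn_shift i : (2 ^ (k + i.+1) = 2 * 2 ^ (k + i))%N.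
Proof. by rewrite addnS expnS. Qed.

Lemma expn_shift_le i j : (i <= j)%N -> (2 ^ (k + i) <= 2 ^ (k + j))%N.
Proof. by move=> ij; rewrite leq_exp2l // leq_add2l. Qed.

Lemma expn_gt0k : (0 < 2 ^ k)%N. Proof. by rewrite expn_gt0. Qed.

Hypothesis cor : corridor.

Lemma target_near j x : (j < M)%N -> target j x -> (l1norm (x - Y j) <= 2 ^ (k + 5))%N.
Proof.
have h1 := expn_shift 0; have h2 := expn_shift 1; have h3 := expn_shift 2.
have h4 := expn_shift 3; have h5 := expn_shift 4.
rewrite addn0 in h1.
case: j => [|j] jM /=.
  move=> /andP[_ hx]; have := l1normB x (Y 0); have := corridor_start cor; lia.
move=> /andP[_ hx]; have := corridor_step cor jM.
have := l1norm_triangle (Y j) x (Y j.+1); have := expn_gt0k; lia.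
Qed.

Lemma target_away j x : (j <= M)%N -> target j x -> (2 ^ k <= l1norm x)%N.
Proof.
have h1 := expn_shift 0; have h2 := expn_shift 1; rewrite addn0 in h1.
case: j => [|j] jM /=; first by lia.
move=> /andP[_ hx]; have := corridor_away cor jM.
have := l1norm_sub_le (Y j) x; lia.
Qed.

Lemma near_target_near j x : (l1norm (x - Y j) <= (2 ^ k).+1)%N ->
  (l1norm (x - Y j) <= 2 ^ (k + 5))%N.
Proof.
move=> hx; apply: leq_trans hx _; have := expn_gt0k.
have := expn_shift 0; have := @expn_shift_le 1 5 isT; rewrite addn0; lia.
Qed.

Lemma near_target_away j x : (j < M)%N -> (l1norm (x - Y j) <= (2 ^ k).+1)%N ->
  (2 ^ k <= l1norm x)%N.
Proof.
move=> jM hx; have := corridor_away cor jM; have := l1norm_sub_le (Y j) x.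
have h1 := expn_shift 0; have h2 := expn_shift 1; rewrite addn0 in h1.
have := expn_gt0k; lia.
Qed.

Lemma target_end x : target M x -> (2 ^ (k + l + 38) <= l1norm x)%N.
Proof.
have := corridor_end cor; have := corridor_nonempty cor.
case: M => [//|j] _ /= he /andP[_ hx].
have := l1norm_sub_le (Y j) x.
have h0 : (2 ^ k <= 2 ^ (k + l + 38))%N by rewrite -addnA leq_exp2l // leq_addr.
rewrite (addnS _ 38) expnS in he; lia.
Qed.

Lemma near_region j x : (j < M)%N -> (l1norm (x - Y j) <= 2 ^ (k + 5))%N ->
  region j.+1 x.
Proof.
by move=> jM hx; rewrite /= jM; apply: leq_trans hx _; exact: expn_shift_le.
Qed.

Lemma target_region i x : target i x -> region i.+1 x.
Proof.
move=> tx; have [iM|] := ltnP i M; first exact: near_region (target_near iM tx).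
rewrite leq_eqVlt => /predU1P[Mi|Mi]; last first.
  by move: tx; case: i Mi => [//|i] Mi /=; rewrite ltnNge -ltnS Mi.
rewrite /= -Mi ltnn; apply: leq_trans (target_end _); last by rewrite Mi.
by rewrite ltn_exp2l // -[X in (X < _)%N]addn0 ltn_add2l.
Qed.

Lemma stage_region h i : stage h = Some i -> region i (current h).
Proof.
case: h => [[<-]//|x h] /=; rewrite /advance.
case: (stage h) => [j|//].
case: ifP => [tx [<-]|_]; first exact: target_region.
by case: ifP => // rx [<-].
Qed.

Lemma region_bounded j x : (j <= M)%N -> region j x -> (l1norm x < 2 ^ (k + B))%N.
Proof.
case: j => [|j] jM.
  move=> /= hx; have := corridor_bounded cor (corridor_nonempty cor).
  by have := @expn_shift_le 2 48 isT; lia.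
rewrite /= jM => hx; have := corridor_bounded cor jM.
have := l1norm_le_sub (Y j) x; lia.
Qed.

End Corridor.
Arguments advance : simpl never.

(** * Lower bound for following a corridor and escaping *)

Section CorridorLower.
Variables (R : realType) (k M l B : nat) (Y : nat -> Z2).
Implicit Types (x y : Z2) (h : seq Z2).
Local Notation a := (potential_kernel R).
Local Notation lv := (level R).
Local Notation stg := (stage k M l Y).
Local Notation reg := (region k M l Y).
Local Notation tgt := (target k M Y).

Hypothesis cor : corridor k M l B Y.
Hypothesis scale_large : 108 * B%:R + 432 <= lv k.

Definition exit_level : R := lv (k + 48) - 3.
Definition outer_level : R := lv (k + B) + 3.
Definition tilt : R := 72 / outer_level.

(** For a walk near the centre [Y j] that dies at the origin. The term
    [a (x - Y j)] rewards approaching the centre, and the level at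
    distance [2 ^ (k + 48)] is subtracted to make the function nonpositive
    on leaving the region. The kernel itself, tilted by a factor that tends to
    0 with the scale, makes it nonpositive at the origin as well. The 48
    octaves make the function at least 1 at distance [2 ^ (k + 5)] in
    spite of the errors in [potential_kernel_bounds]. *)
Definition barrier (j : nat) x : R := exit_level - a (x - Y j) + tilt * (a x - outer_level).

(** Each of the stages costs the constant factor 144, twice the bound 72 of
    [barrier]. *)
Definition weight (i : nat) : R := (144 ^+ (M.+1 - i))^-1.

(** A function that is submartingale along a walk killed at the origin and at
    failure, and at most the potential kernel. Beyond the corridor it is the
    kernel minus its largest value on the ball that must not be revisited.
    Inside the corridor it is a multiple of [barrier]; on a target that was
    already reached on entering a stage, where [barrier] is not harmonic at
    the centre, a small multiple of the kernel takes over. *)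
Definition survival (i : nat) x : R :=
  if i is j.+1 then
    if (j < M)%N then
      if (l1norm (x - Y j) <= 2 ^ k)%N then weight i / outer_level * a x
      else weight i * barrier j x
    else a x - (lv (k + l) + 3)
  else weight 1 / outer_level * a x.

Lemma outer_level_le : outer_level <= lv k + 3 / 2 * B%:R + 3.
Proof. by rewrite /outer_level; have := level_bounds R k B; lra. Qed.

Lemma level_le_outer : lv k + 3 <= outer_level.
Proof. by rewrite /outer_level; have := level_mono R (leq_addr B k); lra. Qed.

Lemma outer_level_ge : 432 <= outer_level.
Proof. have := level_le_outer; have := scale_large; have : 0 <= B%:R :> R by []. lra. Qed.

Lemma tilt_outer_level : tilt * outer_level = 72.
Proof. by rewrite /tilt mulrVK // unitfE; have := outer_level_ge; lra. Qed.

Lemma tilt_ge0 : 0 <= tilt.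
Proof. by rewrite divr_ge0 //; have := outer_level_ge; lra. Qed.

Lemma weight_gt0 i : 0 < weight i.
Proof. by rewrite invr_gt0 exprn_gt0. Qed.

Lemma weightS i : (i <= M)%N -> weight i.+1 = 144 * weight i.
Proof.
move=> iM; rewrite /weight subSS (subSn iM) exprS invfM mulrA divff ?mul1r //.
Qed.

Lemma weight_le1 i : weight i <= 1.
Proof. by rewrite invf_le1 ?exprn_gt0 ?exprn_ege1 ?ler1n. Qed.

Lemma kernel_le_outer x : (l1norm x <= 2 ^ (k + B))%N -> a x <= outer_level.
Proof. exact: kernel_le_level. Qed.

Lemma kernel_ge_half x : (2 ^ k <= l1norm x)%N -> outer_level / 2 <= a x.
Proof.
move=> /(kernel_ge_level R); have := outer_level_le; have := scale_large.
by have : 0 <= B%:R :> R by []; lra.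
Qed.

Lemma barrier_harmonic j x : x != 0 -> x != Y j ->
  \sum_(e < 4) barrier j (x + step e) = 4 * barrier j x.
Proof.
move=> x0; rewrite -subr_eq0 => xY.
have h1 := potential_kernel_harmonic R x0; have h2 := potential_kernel_harmonic R xY.
have e1 e : barrier j (x + step e) =
    (exit_level - tilt * outer_level) + tilt * a (x + step e) - a (x - Y j + step e).
  by rewrite /barrier (addrAC x); move: (a _) (a _) => a1 a2; ring.
rewrite (eq_bigr _ (fun e _ => e1 e)) sumrB big_split /= -mulr_sumr h1 h2.
rewrite sumr_const card_ord -[_ *+ 4]mulr_natl /barrier.
by move: (a _) (a _) => a1 a2; ring.
Qed.

Lemma barrier0 j : (j < M)%N -> barrier j 0 <= 0.
Proof.
move=> jM.
have -> : barrier j 0 = exit_level - a (- Y j) - 72.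
  by rewrite /barrier potential_kernel0 !sub0r mulrN tilt_outer_level.
have : lv (k + 2) - 3 <= a (- Y j).
  by apply: kernel_ge_level; rewrite l1normN; exact: (corridor_away cor).
have := level_diff_le R (leq_add2l k 2 48); rewrite !natrD /exit_level; lra.
Qed.

Lemma tilt_term_le x : (l1norm x <= 2 ^ (k + B))%N -> tilt * (a x - outer_level) <= 0.
Proof. by move=> /kernel_le_outer h; rewrite mulr_ge0_le0 ?tilt_ge0 // subr_le0. Qed.

Lemma barrier_out j x : (2 ^ (k + 48) <= l1norm (x - Y j))%N ->
  (l1norm x <= 2 ^ (k + B))%N -> barrier j x <= 0.
Proof.
by move=> /(kernel_ge_level R) h1 /tilt_term_le h2; rewrite /barrier /exit_level; lra.
Qed.

Lemma barrier_le j x : (2 ^ k <= l1norm (x - Y j))%N ->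
  (l1norm x <= 2 ^ (k + B))%N -> barrier j x <= 72.
Proof.
move=> /(kernel_ge_level R) h1 /tilt_term_le h2; rewrite /barrier /exit_level.
by have := level_diff_le R (leq_addr 48 k); rewrite natrD; lra.
Qed.

Lemma barrier_ge j x : (l1norm (x - Y j) <= 2 ^ (k + 5))%N -> (2 ^ k <= l1norm x)%N ->
  1 <= barrier j x.
Proof.
move=> /(kernel_le_level R) h1 /(kernel_ge_level R) h2; rewrite /barrier /exit_level.
have hk : tilt * (lv k - 3 - outer_level) <= tilt * (a x - outer_level).
  by rewrite ler_wpM2l ?tilt_ge0 //; lra.
(* The tilt costs at most 1, because the scale is large. *)
have hk1 : - 1 <= tilt * (lv k - 3 - outer_level).
  have Lp := outer_level_ge; rewrite /tilt mulrAC ler_pdivlMr; last by lra.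
  by have := outer_level_le; have := level_le_outer; have := scale_large; lra.
by have := level_diff_ge R (leq_add2l k 5 48); rewrite !natrD; lra.
Qed.

(** On reaching a target the walk is again at a typical distance from the next
    centre, or far enough out, so the next function has a value comparable to
    its weight. *)
Lemma survival_enter i x : (i <= M)%N -> tgt i x -> (l1norm x <= 2 ^ (k + B))%N ->
  weight i.+1 / outer_level * a x <= survival i.+1 x.
Proof.
move=> iM tx xB; have Lp := outer_level_ge; have w0 := weight_gt0 i.+1.
have xL := kernel_le_outer xB.
move: iM; rewrite leq_eqVlt => /predU1P[iM|iM].
  rewrite iM /= ltnn -iM.
  have : weight i.+1 / outer_level * a x <= weight i.+1.
    by rewrite mulrAC ler_pdivrMr ?ler_wpM2l //; lra.
  rewrite iM in tx; have := kernel_ge_level R (target_end cor tx).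
  have := weight_le1 i.+1.
  have := level_diff_ge R (leq_addr 38 (k + l)); rewrite !natrD; lra.
rewrite /= iM; case: ifP => // _.
have := barrier_ge (target_near cor iM tx) (target_away cor (ltnW iM) tx).
have : weight i.+1 / outer_level * a x <= weight i.+1.
  by rewrite mulrAC ler_pdivrMr ?ler_wpM2l //; lra.
nra.
Qed.

Lemma survival_target i x : (i <= M)%N -> tgt i x -> (l1norm x <= 2 ^ (k + B))%N ->
  72 * weight i <= survival i.+1 x.
Proof.
move=> iM tx xB; apply: le_trans (survival_enter iM tx xB).
have Lp := outer_level_ge; have w0 := weight_gt0 i; have := kernel_ge_half (target_away cor iM tx).
rewrite (weightS iM) mulrAC ler_pdivlMr; last by lra.
nra.
Qed.

Lemma off_target j x y : (j < M)%N -> ~~ tgt j.+1 y ->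
  survival j.+1 y = weight j.+1 * barrier j y.
Proof. by move=> jM /=; rewrite jM /= => /negbTE ->. Qed.

Definition next_survival i y : R :=
  if advance k M l Y (Some i) y is Some j then survival j y else 0.

(** At the current point the function agrees with a harmonic one that is
    nonpositive at the origin; at each neighbour the true next value,
    including 0 at failure, dominates that harmonic function. *)
Lemma survival_sub i x : x != 0 -> reg i x ->
  survival i x <= killed_mean (next_survival i) x.
Proof.
move=> x0 rx; have Lp := outer_level_ge.
have kp := expn_gt0k k; have k48 := @expn_shift_le k 3 48 isT.
have k1 := expn_shift k 0; have k2 := expn_shift k 1; have k3 := expn_shift k 2.
have k4 := expn_shift k 3; have k5 := expn_shift k 4; rewrite addn0 in k1.
have k5' := @expn_shift_le k 5 48 isT.
have B3 := corridor_bounded cor (corridor_nonempty cor).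
have sumc c : \sum_(e < 4) (c * a (x + step e)) = 4 * (c * a x).
  by rewrite -mulr_sumr potential_kernel_harmonic // mulrCA.
have nbr y e : (l1norm (x + step e - y) <= (l1norm (x - y)).+1)%N.
  by rewrite addrAC l1norm_stepD.
have nbr' y e : (l1norm (x - y) <= (l1norm (x + step e - y)).+1)%N.
  by rewrite addrAC l1norm_stepD_ge.
case: i rx => [|j] rx.
  apply: le_trans (killed_mean_sub (f := fun y => weight 1 / outer_level * a y) (sumc _) _) _.
    by rewrite potential_kernel0 mulr0.
  apply: ler_killed_mean => e y0; rewrite /next_survival /advance.
  have hy := l1norm_stepD x e; rewrite /= in rx.
  case: ifP => [ty|/negbT nty].
    by apply: survival_enter => //; lia.
  by case: ifP => [//|/negbT nry]; move: nty nry => /=; lia.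
have [jM|jM] := ltnP j M; last first.
  rewrite /= ltnNge jM /= in rx *.
  apply: le_trans (killed_mean_sub (f := fun y => a y - (lv (k + l) + 3)) _ _) _.
  - rewrite sumrB potential_kernel_harmonic // sumr_const card_ord -[_ *+ 4]mulr_natl; ring.
  - by rewrite potential_kernel0; have := level_ge R (k + l); have : 0 <= (k + l)%:R :> R by []; lra.
  apply: ler_killed_mean => e y0; rewrite /next_survival /advance /= ltnNge jM /=.
  case: ifP => [_|/negbT nry]; first by rewrite /= ltnNge jM.
  by rewrite /= subr_le0; apply: kernel_le_level; rewrite leqNgt.
have rB := region_bounded cor jM rx.
have wj := weight_gt0 j.+1.
have yB e : (l1norm (x + step e) <= 2 ^ (k + B))%N.
  exact: leq_trans (l1norm_stepD x e) rB.
rewrite /= jM in rx *; case: ifPn => [tx|ntx].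
  apply: le_trans (killed_mean_sub (f := fun y => weight j.+1 / outer_level * a y) (sumc _) _) _.
    by rewrite potential_kernel0 mulr0.
  apply: ler_killed_mean => e y0; rewrite /next_survival /advance.
  have hy : (l1norm (x + step e - Y j) <= (2 ^ k).+1)%N by apply: leq_trans (nbr _ e) _.
  have aL := kernel_le_outer (yB e); have a0 := kernel_ge0 R (x + step e).
  case: ifP => [ty|/negbT nty].
    apply: le_trans (survival_enter jM ty (yB e)).
    by rewrite (weightS jM) ler_wpM2r // ler_wpM2r ?invr_ge0; lra.
  rewrite /= jM (leq_trans (near_target_near hy) k5').
  move: nty => /=; rewrite jM /= => /negbTE ->.
  have : 1 <= barrier j (x + step e).
    exact: barrier_ge (near_target_near hy) (near_target_away cor jM hy).
  have : weight j.+1 / outer_level * a (x + step e) <= weight j.+1.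
    by rewrite mulrAC ler_pdivrMr ?ler_wpM2l //; lra.
  nra.
have xY : x != Y j.
  by apply: contraNneq ntx => ->; rewrite subrr.
apply: le_trans (killed_mean_sub (f := fun y => weight j.+1 * barrier j y) _ _) _.
- by rewrite -mulr_sumr barrier_harmonic // mulrCA.
- by rewrite pmulr_rle0 // barrier0.
apply: ler_killed_mean => e y0; rewrite /next_survival /advance.
have hy := nbr' (Y j) e.
case: ifP => [ty|/negbT nty].
  apply: le_trans (survival_target jM ty (yB e)).
  rewrite mulrC ler_pM2r //; apply: barrier_le => //.
  by rewrite -ltnS; apply: leq_trans hy; rewrite ltnNge.
case: ifP => [ry|/negbT nry]; first by rewrite (off_target _ jM nty).
rewrite pmulr_rle0 //; apply: barrier_out => //.
by move: nry; rewrite /= jM -ltnNge; exact: ltnW.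
Qed.

Definition survival_history h : R :=
  if stg h is Some i then survival i (current h) else 0.

Lemma survival_le_kernel i x : x != 0 -> reg i x -> survival i x <= a x.
Proof.
move=> x0 rx; have a34 := potential_kernel_ge R x0; have Lp := outer_level_ge.
have wL j : weight j / outer_level * a x <= a x.
  rewrite ler_piMl //; first by lra.
  by rewrite ler_pdivrMr ?mul1r; have := weight_le1 j; lra.
case: i rx => [|j] rx /=; first exact: wL.
case: ifPn => jM; last by have := level_ge R (k + l); have : 0 <= (k + l)%:R :> R by []; lra.
case: ifPn => tx; first exact: wL.
have : barrier j x <= 72.
  by apply: barrier_le; [lia|exact: ltnW (region_bounded cor jM rx)].
have := weightS jM; have := weight_le1 j.+2; have := weight_gt0 j.+1; nra.
Qed.

(** After division by the value of the potential kernel, this says that the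
    conditioned walk follows the corridor and never returns with probability
    at least a constant over [outer_level], that is, of order [1 / k]. *)
Lemma corridor_survival N h : stg h = Some 0%N -> current h != 0 ->
  weight 1 / outer_level * a (current h) <=
  walk_sum N (fun h => a (current h) * (stg h : bool)%:R) h.
Proof.
move=> sh h0.
pose I h := current h != 0.
have Icl : step_closed I by [].
have -> : weight 1 / outer_level * a (current h) = survival_history h by rewrite /survival_history sh.
apply: le_trans (walk_sum_sub (u := survival_history) N Icl _ h0) _.
  move=> h1 I1; rewrite /survival_history /=; case E: (stg h1) => [i|] /=.
    exact: survival_sub I1 (stage_region cor E).
  by rewrite /killed_mean big1 ?mul0r // => e _; rewrite if_same.
apply: (ler_walk_sum (I := I)) => // h1 I1; rewrite /survival_history.
case E: (stg h1) => [i|] /=; last by rewrite mulr0.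
by rewrite mulr1; exact: survival_le_kernel I1 (stage_region cor E).
Qed.

End CorridorLower.

(** * Upper bound for two corridors at once *)

Section AdvanceLate.
Variables (k M l : nat) (Y : nat -> Z2).

Lemma advance_late i y i' : advance k M l Y (Some i) y = Some i' ->
  (M < i')%N -> (M < i)%N \/ i = M /\ target k M Y M y.
Proof.
rewrite /advance; case: ifP => [ty [<-]|_]; last by case: ifP => // _ [<-]; left.
rewrite ltnS leq_eqVlt => /predU1P[Mi|]; last by left.
by rewrite -Mi in ty *; right.
Qed.

Lemma advance_stay i y i' : advance k M l Y (Some i) y = Some i' ->
  (M < i)%N -> (M < i')%N.
Proof.
rewrite /advance; case: ifP => [ty [<-]|_]; last by case: ifP => // _ [<-].
exact: ltnW.
Qed.

End AdvanceLate.

Section PairUpper.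
Variables (R : realType) (M l B k j : nat) (Yk Yj : nat -> Z2).
Implicit Types (x y : Z2) (h : seq Z2).
Local Notation a := (potential_kernel R).
Local Notation lv := (level R).

Hypothesis cork : corridor k M l B Yk.
Hypothesis corj : corridor j M l B Yj.
Hypothesis separated : (k + B < j)%N.
Hypothesis scale_large : 6 <= lv k.

Definition inner_level (i : nat) : R := lv (i + l) - 3.
Definition width : R := 3 / 2 * B%:R + 6.
Definition pair_beta : R := width / (3 / 16 * (j%:R - k%:R)).
Definition pair_gamma : R := pair_beta * width / (lv k / 2).

(** A supermartingale for surviving in two corridors: the kernel minus an
    inner level once the outer corridor is completed, a multiple of order
    [1 / (j - k)] of the same for the inner corridor before that, and a
    multiple of order [1 / (k * (j - k))] of the kernel at the
    beginning. *)
Definition pair_value (p q : nat) x : R :=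
  if (M < q)%N then a x - inner_level j
  else if (M < p)%N then pair_beta * (a x - inner_level k)
  else pair_gamma * a x.

Definition pair_potential h : R :=
  match stage k M l Yk h, stage j M l Yj h with
  | Some p, Some q => pair_value p q (current h)
  | _, _ => 0
  end.

Lemma scale_gap_gt0 : 0 < j%:R - k%:R :> R.
Proof. by rewrite subr_gt0 ltr_nat; apply: leq_ltn_trans separated; rewrite leq_addr. Qed.

Lemma width_ge : 6 <= width.
Proof. by rewrite /width; have : 0 <= B%:R :> R by []; lra. Qed.

Lemma pair_beta_gt0 : 0 < pair_beta.
Proof. by rewrite divr_gt0 ?mulr_gt0 ?divr_gt0 ?scale_gap_gt0 //; have := width_ge; lra. Qed.

Lemma pair_gamma_gt0 : 0 < pair_gamma.
Proof.
have w := width_ge; have b := pair_beta_gt0; have := scale_large => lk.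
by rewrite /pair_gamma; apply: divr_gt0; [apply: mulr_gt0|]; lra.
Qed.

Lemma kernel_inner_le i x : (l1norm x <= 2 ^ (i + B))%N -> a x - inner_level i <= width.
Proof.
move=> /(kernel_le_level R); rewrite /inner_level /width.
have := level_bounds R i B; have := level_mono R (leq_addr l i); lra.
Qed.

Lemma kernel_inner_ge0 i x : (2 ^ (i + l) <= l1norm x)%N -> 0 <= a x - inner_level i.
Proof. by move=> /(kernel_ge_level R); rewrite /inner_level; lra. Qed.

Lemma late_region i Y p x : region i M l Y p x -> (M < p)%N -> (2 ^ (i + l) < l1norm x)%N.
Proof. by case: p => [//|p] /=; rewrite ltnS => + Mp; rewrite ltnNge Mp. Qed.

(** The constants are chosen so that the function does not increase when the
    end of a corridor is reached. The separation of the two scales excludes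
    that the outer corridor is completed before the inner one. *)
Lemma pair_super p q x : x != 0 -> region k M l Yk p x -> region j M l Yj q x ->
  killed_mean (fun y => match advance k M l Yk (Some p) y, advance j M l Yj (Some q) y with
    | Some p', Some q' => pair_value p' q' y | _, _ => 0 end) x <= pair_value p q x.
Proof.
move=> x0 rp rq.
have kp := expn_gt0k (k + l); have jp := expn_gt0k (j + l).
have b0 := pair_beta_gt0; have g0 := pair_gamma_gt0.
have wp := width_ge.
have affine c d : \sum_(e < 4) (c * (a (x + step e) - d)) = 4 * (c * (a x - d)).
  rewrite -mulr_sumr sumrB potential_kernel_harmonic // sumr_const card_ord.
  by rewrite -[_ *+ 4]mulr_natl; ring.
rewrite {2}/pair_value; case: (ltnP M q) => Mq.
  have xl := late_region rq Mq.
  rewrite -[leRHS]mul1r.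
  apply: le_trans _ (killed_mean_super (f := fun y => 1 * (a y - inner_level j)) (affine 1 _) _);
    last by apply/orP; right; lia.
  apply: ler_killed_mean => e y0; rewrite mul1r.
  have yl : 0 <= a (x + step e) - inner_level j.
    by apply: kernel_inner_ge0; rewrite -ltnS; exact: leq_trans xl (l1norm_stepD_ge x e).
  case: (advance k) => [p'|//].
  case E: (advance j) => [q'|//].
  by rewrite /pair_value (advance_stay E Mq).
have qB := region_bounded corj Mq rq.
case: (ltnP M p) => Mp.
  have xl := late_region rp Mp.
  apply: le_trans _ (killed_mean_super (f := fun y => pair_beta * (a y - inner_level k)) (affine _ _) _);
    last by apply/orP; right; lia.
  apply: ler_killed_mean => e y0 /=.
  have yl : 0 <= a (x + step e) - inner_level k.
    by apply: kernel_inner_ge0; rewrite -ltnS; exact: leq_trans xl (l1norm_stepD_ge x e).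
  case E1: (advance k) => [p'|]; last by apply: mulr_ge0 => //; exact: ltW.
  case E2: (advance j) => [q'|]; last by apply: mulr_ge0 => //; exact: ltW.
  rewrite /pair_value (advance_stay E1 Mp); case: ifP => // Mq'.
  have [|[_ ty]] := advance_late E2 Mq'; first by rewrite ltnNge Mq.
  have h1 : a (x + step e) - inner_level j <= width.
    by apply: kernel_inner_le; exact: leq_trans (l1norm_stepD x e) qB.
  have h2 : 3 / 16 * (j%:R - k%:R) <= a (x + step e) - inner_level k.
    have := kernel_ge_level R (target_end corj ty).
    have := level_diff_ge R (_ : (k + l <= j + l + 38)%N).
    have -> : (k + l <= j + l + 38)%N.
      by rewrite -addnA leq_add ?leq_addr // (leq_trans (leq_addr B k)) // ltnW.
    move=> /(_ isT); rewrite /inner_level !natrD; lra.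
  apply: le_trans h1 _; apply: le_trans (_ : pair_beta * (3 / 16 * (j%:R - k%:R)) <= _).
    by rewrite /pair_beta mulrVK // unitfE; have := scale_gap_gt0; lra.
  by rewrite ler_pM2l.
have pB := region_bounded cork Mp rp.
have affine0 : \sum_(e < 4) (pair_gamma * a (x + step e)) = 4 * (pair_gamma * a x).
  by rewrite -mulr_sumr potential_kernel_harmonic // mulrCA.
apply: le_trans _ (killed_mean_super (f := fun y => pair_gamma * a y) affine0 _) => //;
  last by rewrite potential_kernel0 mulr0 lexx.
apply: ler_killed_mean => e y0 /=.
have hy := l1norm_stepD x e; have a0 := kernel_ge0 R (x + step e).
have nn : 0 <= pair_gamma * a (x + step e) by rewrite mulr_ge0 // ltW.
case E1: (advance k) => [p'|//]; case E2: (advance j) => [q'|//].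
rewrite /pair_value; case: ifP => Mq'.
  have [|[_ ty]] := advance_late E2 Mq'; first by rewrite ltnNge Mq.
  have lt : (2 ^ (k + B) < 2 ^ (j + l + 38))%N.
    by rewrite ltn_exp2l // (leq_trans separated) // -addnA leq_addr.
  have := leq_trans lt (leq_trans (target_end corj ty) (leq_trans hy pB)).
  by rewrite ltnn.
case: ifP => // Mp'.
have [|[_ ty]] := advance_late E1 Mp'; first by rewrite ltnNge Mp.
have h1 : a (x + step e) - inner_level k <= width by apply: kernel_inner_le; exact: leq_trans hy pB.
have h2 : lv k / 2 <= a (x + step e).
  have := kernel_ge_level R (target_away cork (leqnn M) ty); have := scale_large; lra.
apply: le_trans (_ : pair_beta * width <= _); first by rewrite ler_pM2l.
rewrite /pair_gamma [leRHS]mulrAC ler_pdivlMr; last by have := scale_large; lra.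
by rewrite ler_wpM2l // mulr_ge0 // ltW //; lra.
Qed.

Lemma pair_value_ge0 p q x : region k M l Yk p x -> region j M l Yj q x ->
  0 <= pair_value p q x.
Proof.
move=> rp rq; rewrite /pair_value; case: ifP => Mq.
  by apply: kernel_inner_ge0; apply: ltnW; exact: late_region rq Mq.
case: ifP => Mp.
  apply: mulr_ge0; first exact: ltW pair_beta_gt0.
  by apply: kernel_inner_ge0; apply: ltnW; exact: late_region rp Mp.
by apply: mulr_ge0; [exact: ltW pair_gamma_gt0|exact: kernel_ge0].
Qed.

Lemma pair_potential_ge0 h : 0 <= pair_potential h.
Proof.
rewrite /pair_potential.
case E1: (stage k M l Yk h) => [p|//]; case E2: (stage j M l Yj h) => [q|//].
exact: pair_value_ge0 (stage_region cork E1) (stage_region corj E2).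
Qed.

Definition both_survive h : R :=
  (stage k M l Yk h : bool)%:R * (stage j M l Yj h : bool)%:R.

Lemma both_survive_le1 h : 0 <= both_survive h <= 1.
Proof. by rewrite /both_survive -natrM ler0n lern1; case: (stage k _ _ _ _); case: stage. Qed.

(** Far away the supermartingale exceeds half of the kernel on survival, and
    the part of the expectation carried by a fixed ball vanishes as time
    grows, by [walk_sum_ball]. *)
Lemma pair_survival : exists D, forall N h,
  stage k M l Yk h = Some 0%N -> stage j M l Yj h = Some 0%N -> current h != 0 ->
  walk_sum N.+1 (fun h => a (current h) * both_survive h) h <=
  2 * pair_gamma * a (current h) + D / N.+1%:R.
Proof.
have [r rB rbig] : exists2 r, (j + B <= r)%N & 2 * inner_level j + 3 <= lv r.
  exists (j + B + Num.bound (`|2 * inner_level j + 3| * 16 / 3)%R)%N; first exact: leq_addr.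
  set b := Num.bound _; have := archi_boundP (_ : 0 <= `|2 * inner_level j + 3| * 16 / 3).
  have -> : 0 <= `|2 * inner_level j + 3| * 16 / 3 by rewrite !mulr_ge0.
  move=> /(_ isT); rewrite -/b; have := level_ge R (j + B + b).
  rewrite natrD; have := ler_norm (2 * inner_level j + 3); have : 0 <= (j + B)%:R :> R by [].
  lra.
exists ((lv r + 3) * (2 * 2 ^ r + 1)%:R ^+ 2) => N h sk sj h0.
have lvr : 0 <= lv r + 3 by have := level_ge R r; have : 0 <= r%:R :> R by []; lra.
pose I h := current h != 0.
have Icl : step_closed (fun h => I h) by [].
apply: le_trans (_ : walk_sum N.+1 (fun h => 2 * pair_potential h
   + (lv r + 3) * (l1norm (current h) <= 2 ^ r)%N%:R) h <= _).
  apply: (ler_walk_sum (I := fun h => I h)) => // h1 I1.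
  have ph := pair_potential_ge0 h1; have bh := both_survive_le1 h1; have ah := kernel_ge0 R (current h1).
  case: leqP => hr.
    have := kernel_le_level R hr; rewrite mulr1; nra.
  rewrite mulr0 addr0 /pair_potential /both_survive.
  case E1: (stage k M l Yk h1) => [p|]; last by rewrite !mul0r !mulr0.
  case E2: (stage j M l Yj h1) => [q|]; last by rewrite !mulr0.
  have Mq : (M < q)%N.
    rewrite ltnNge; apply/negP => qM; have := region_bounded corj qM (stage_region corj E2).
    move=> /ltnW xr; move: hr; rewrite ltnNge (leq_trans xr) //.
    by rewrite leq_exp2l.
  rewrite /pair_value Mq /= !mulr1.
  have := kernel_ge_level R (ltnW hr); lra.
rewrite walk_sumD !walk_sumZ lerD //.
  rewrite -mulrA ler_pM2l //.
  have -> : pair_gamma * a (current h) = pair_potential h by rewrite /pair_potential sk sj.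
  apply: (walk_sum_super (I := fun h => I h)) => // h1 I1.
  rewrite /pair_potential /=.
  case E1: (stage k M l Yk h1) => [p|]; last first.
    by rewrite /killed_mean big1 ?mul0r // => e _; rewrite if_same.
  case E2: (stage j M l Yj h1) => [q|].
    exact: pair_super I1 (stage_region cork E1) (stage_region corj E2).
  rewrite /killed_mean big1 ?mul0r // => e _.
  by case: ifP => // _; case: (advance k M l Yk (Some p) (current h1 + step e)).
by rewrite -mulrA ler_wpM2l // walk_sum_ball.
Qed.

End PairUpper.

(** * Second moment and harmonic sums *)

Section SecondMoment.
Variable R : realType.

Lemma sqr_sum_indicator (X : nat -> bool) A n :
  (\sum_(A <= i < n) (X i)%:R) ^+ 2 = \sum_(A <= i < n) (X i)%:R
    + 2 * \sum_(A <= j < n) \sum_(A <= i < j) (X i)%:R * (X j)%:R :> R.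
Proof.
have [nA|An] := leqP n A; first by rewrite !big_geq // expr0n mulr0 addr0.
elim: n {An}(ltnW An) => [|n IH] An.
  by rewrite !big_geq // expr0n mulr0 addr0.
move: An; rewrite leq_eqVlt => /predU1P[<-|].
  by rewrite !big_geq // expr0n mulr0 addr0.
rewrite ltnS => An; rewrite !(big_nat_recr n) //= -mulr_suml sqrrD IH //.
have -> : (X n)%:R ^+ 2 = (X n)%:R :> R by case: (X n); rewrite ?expr1n ?expr0n.
rewrite mulrDr -(mulr_natl _ 2); ring.
Qed.

(** From [1 - (1 - t * S) ^+ 2 <= 1] for the number [S] of
    successes, which vanishes when there are none. The bound is linear in the
    indicators of single and pair events, so expectations can be taken term by
    term. *)
Lemma second_moment_pointwise (X : nat -> bool) A n (t : R) : 0 <= t <= 1 ->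
  t * \sum_(A <= i < n) (X i)%:R
    - 2 * t ^+ 2 * \sum_(A <= j < n) \sum_(A <= i < j) (X i)%:R * (X j)%:R
  <= (has X (index_iota A n))%:R.
Proof.
move=> t01; have := sqr_sum_indicator X A n.
set P := \sum_(_ <= _ < _) \sum_(_ <= _ < _) _; set S := \sum_(_ <= _ < _) _ => e.
have S0 : 0 <= S by apply: sumr_ge0.
case: (boolP (has X _)) => [_|/hasPn hX] /=; last first.
  have S00 : S = 0.
    by rewrite /S big_seq_cond big1 // => i /andP[/hX /negbTE -> _].
  have : P = 0 by move: e; rewrite S00 expr0n /=; lra.
  by move=> ->; rewrite S00 !mulr0 subrr.
have -> : 2 * t ^+ 2 * P = t ^+ 2 * (S ^+ 2 - S) by rewrite e; ring.
by have := sqr_ge0 (1 - t * S); nra.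
Qed.

Definition hsum (A n : nat) : R := \sum_(A <= i < n) i%:R^-1.

Lemma hsum_ge0 A n : 0 <= hsum A n.
Proof. by apply: sumr_ge0 => i _; rewrite invr_ge0. Qed.

Lemma hsum_unbounded (C : R) A : exists2 n, (A < n)%N & C <= hsum 1 n.
Proof.
have mono : nondecreasing_seq (series (@harmonic R)).
  by apply/nondecreasing_series => i _ _; rewrite invr_ge0.
have [H|/existsNP[n /negP]] := pselect (forall n, series (@harmonic R) n <= C).
  case: (@dvg_harmonic R); apply: nondecreasing_is_cvgn mono _.
  by exists C => _ [n _ <-].
rewrite -ltNge => /ltW Cn; exists (n + A).+1; first by rewrite ltnS leq_addl.
apply: le_trans Cn _; apply: le_trans (mono _ _ (leq_addr A n)) _.
by rewrite /series /= /hsum big_add1.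
Qed.

Lemma hsum_mono A m n : (m <= n)%N -> hsum A m <= hsum A n.
Proof.
move=> mn; rewrite /hsum; have [Am|mA] := leqP A m; last first.
  by rewrite (big_geq (ltnW mA)) hsum_ge0.
by rewrite [leRHS](big_cat_nat _ mn) //= lerDl hsum_ge0.
Qed.

Lemma hsum_cat A n : (0 < A <= n)%N -> hsum 1 n = hsum 1 A + hsum A n.
Proof. by move=> /andP[A0 An]; rewrite /hsum (big_cat_nat _ An). Qed.

Lemma hsum_le A n : (0 < A)%N -> hsum A n <= hsum 1 n.
Proof.
move=> A0; have [An|nA] := leqP A n; first by rewrite (hsum_cat (A := A)) ?A0 // lerDr hsum_ge0.
by rewrite {1}/hsum big_geq ?hsum_ge0 // ltnW.
Qed.

(** Reversing the summation index turns the distances to [j] into an initial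
    segment of the harmonic series. *)
Lemma sum_inv_dist A j : (A <= j)%N ->
  \sum_(A <= i < j) (j%:R - i%:R)^-1 = hsum 1 (j - A).+1.
Proof.
move=> Aj; rewrite big_nat_rev -{1}[A]add0n big_addn /hsum big_add1 /=.
apply: eq_big_nat => i /andP[_ hi]; congr (_^-1); rewrite -natrB; last by lia.
by congr _%:R; lia.
Qed.

(** Uses [1 / (i * (j - i)) = (1 / i + 1 / (j - i)) / j]. *)
Lemma hsum_pairs A n : (0 < A)%N ->
  \sum_(A <= j < n) \sum_(A <= i < j) (i%:R * (j%:R - i%:R))^-1 <=
  2 * hsum A n * hsum 1 n.
Proof.
move=> A0; rewrite mulrAC mulr_sumr; apply: ler_sum_nat => j /andP[Aj jn].
have j0 : 0 < j%:R :> R by rewrite ltr0n; lia.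
rewrite (eq_big_nat _ _ (F2 := fun i => (i%:R^-1 + (j%:R - i%:R)^-1) * j%:R^-1)); last first.
  move=> i /andP[Ai ij]; have i0 : 0 < i%:R :> R by rewrite ltr0n; lia.
  have : i%:R < j%:R :> R by rewrite ltr_nat.
  by move=> ?; field; rewrite !gt_eqF //= subr_gt0.
rewrite -mulr_suml ler_pM2r ?invr_gt0 // big_split /= sum_inv_dist // mulr_natl mulr2n.
apply: lerD; first exact: le_trans (hsum_mono _ (ltnW jn)) (hsum_le _ A0).
by apply: hsum_mono; lia.
Qed.

End SecondMoment.

(** * Success at some scale with uniformly positive probability *)

Lemma stage_start k M l Y (h : seq Z2) :
  all (fun x => l1norm x <= 2 ^ (k + 2))%N h -> stage k M l Y h = Some 0%N.
Proof.
by elim: h => [//|x h IH] /= /andP[hx /IH ->]; rewrite /advance /= ltnNge hx.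
Qed.

Section ManyScales.
Variables (R : realType) (M l B i0 : nat) (Y : nat -> nat -> Z2).
Implicit Types (x y : Z2) (h : seq Z2).
Local Notation a := (potential_kernel R).
Local Notation lv := (level R).

(** Consecutive scales are separated by more than the width [B] of a corridor,
    as [pair_super] requires. *)
Definition scale (i : nat) := (B.+1 * i)%N.

Definition survives (i : nat) h : bool := stage (scale i) M l (Y i) h.

Hypothesis i0_gt0 : (0 < i0)%N.
Hypothesis cor : forall i, (i0 <= i)%N -> corridor (scale i) M l B (Y i).
Hypothesis scale_large : forall i, (i0 <= i)%N -> 108 * B%:R + 432 <= lv (scale i).

(** At scale [i] the level is proportional to [i], so [corridor_survival] is a
    bound of order [1 / i]. *)
Lemma survives_lower : exists2 c, 0 < c <= 1 & forall i N h, (i0 <= i)%N ->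
  stage (scale i) M l (Y i) h = Some 0%N -> current h != 0 ->
  c / i%:R * a (current h) <=
  walk_sum N (fun h => a (current h) * (survives i h)%:R) h.
Proof.
have w0 := weight_gt0 R M 1; have w1 := weight_le1 R M 1.
have B0 : 0 <= B%:R :> R by [].
have K0 : 0 < 7 + 3 * B%:R :> R by lra.
(* By [level_le], [outer_level] at scale [i] is at most [(7 + 3 * B) * i]. *)
exists (weight R M 1 / (7 + 3 * B%:R)).
  rewrite divr_gt0 // ler_pdivrMr //; lra.
move=> i N h ii0 sh h0; have i1 : 1 <= i%:R :> R by rewrite ler1n; lia.
apply: le_trans (corridor_survival (cor ii0) (scale_large ii0) N sh h0).
rewrite ler_wpM2r ?kernel_ge0 // -mulrA; apply: ler_wpM2l; first exact: ltW.
rewrite -invfM lef_pV2 ?posrE.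
- have := level_le R (scale i + B); rewrite /outer_level /scale natrD natrM -(natr1 B); nra.
- by rewrite mulr_gt0 //; lra.
- by rewrite /outer_level; have := level_ge R (scale i + B); have : 0 <= (scale i + B)%:R :> R by []; lra.
Qed.

Lemma survives_pair_upper : exists2 C, 1 <= C & forall i j, (i0 <= i < j)%N ->
  exists D, forall N h,
  stage (scale i) M l (Y i) h = Some 0%N -> stage (scale j) M l (Y j) h = Some 0%N ->
  current h != 0 ->
  walk_sum N.+1 (fun h => a (current h) * ((survives i h)%:R * (survives j h)%:R)) h <=
  C * (i%:R * (j%:R - i%:R))^-1 * a (current h) + D / N.+1%:R.
Proof.
have B0 : 0 <= B%:R :> R by [].
have w6 := width_ge R B; set w := width R B in w6.
exists (256 * w ^+ 2); first nra.
move=> i j /andP[ii0 ij]; have jj0 := leq_trans ii0 (ltnW ij).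
have sep : (scale i + B < scale j)%N.
  apply: leq_trans (_ : scale i.+1 <= _)%N; last by rewrite leq_mul2l.
  by rewrite /scale mulnS addnC addSn.
have s6 : 6 <= lv (scale i) by have := scale_large ii0; lra.
have [D hD] := pair_survival (cor ii0) (cor jj0) sep s6.
exists D => N h si sj h0; apply: le_trans (hD N h si sj h0) _.
rewrite lerD2r ler_wpM2r ?kernel_ge0 //.
have i1 : 1 <= i%:R :> R by rewrite ler1n; lia.
have ji : 0 < j%:R - i%:R :> R by rewrite subr_gt0 ltr_nat.
have lvi : 3 / 16 * i%:R <= lv (scale i).
  by have := level_ge R (scale i); rewrite /scale natrM -(natr1 B); nra.
rewrite /pair_gamma /pair_beta -/w.
have -> : (scale j)%:R - (scale i)%:R = (B%:R + 1) * (j%:R - i%:R) :> R.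
  by rewrite !natrM natr1 mulrBr.
move: (lv (scale i)) s6 lvi => L L6 Li.
set d : R := j%:R - i%:R in ji *; set n : R := i%:R in i1 Li *.
rewrite (_ : 2 * _ = (64 / 3 * w ^+ 2) * ((B%:R + 1) * d * L)^-1); last first.
  by field; rewrite !gt_eqF //; lra.
rewrite (_ : 256 * w ^+ 2 = (64 / 3 * w ^+ 2) * 12); last by field.
rewrite -[leRHS]mulrA; apply: ler_wpM2l; first by have := sqr_ge0 w; lra.
rewrite -[12]invrK -invfM lef_pV2 ?posrE.
- have dL : 0 <= d * L by apply: mulr_ge0; lra.
  have nd : n * d <= 16 / 3 * (d * L) by nra.
  have BdL : 0 <= B%:R * (d * L) by apply: mulr_ge0.
  have -> : (B%:R + 1) * d * L = B%:R * (d * L) + d * L by ring.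
  lra.
- by rewrite !mulr_gt0 //; lra.
- by rewrite mulr_gt0 ?mulr_gt0 ?invr_gt0 //; lra.
Qed.

Definition some_survives A n h : bool := has (survives ^~ h) (index_iota A n).

Lemma scale_ge i : (i <= 2 ^ (scale i + 2))%N.
Proof.
apply: leq_trans (ltnW (ltn_expl i (isT : (1 < 2)%N))) _.
by rewrite leq_exp2l // /scale mulSn; lia.
Qed.

(** A given past lies in the stage-0 ball of every sufficiently large scale,
    so it does not influence what happens there. *)
Lemma start_stages m h : exists A, [/\ (m <= A)%N, (i0 <= A)%N &
  forall i, (A <= i)%N -> stage (scale i) M l (Y i) h = Some 0%N].
Proof.
exists (m + i0 + \sum_(x <- h) l1norm x)%N; split; [lia|lia|move=> i hi].
apply: stage_start; apply/allP => x xh; apply: leq_trans (scale_ge i).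
apply: leq_trans hi; apply: leq_trans (leq_addl _ _).
by rewrite (big_rem x xh) /= leq_addr.
Qed.

(** The expected number of successes over the scales between [A] and [n] is at
    least of order [hsum A n], and the expected number of pairs at most of
    order [hsum A n * hsum 1 n]. As the harmonic series diverges, [n]
    can be taken so large that the two sums are comparable; the probability of
    a success is then bounded below by a constant that depends neither on the
    past nor on the scales. *)
Lemma some_survives_lower : exists2 delta : R, 0 < delta & forall m h, current h != 0 ->
  exists A n N0, (m <= A)%N /\ forall N, (N0 <= N)%N ->
    delta * a (current h) <=
    walk_sum N (fun h => a (current h) * (some_survives A n h)%:R) h.
Proof.
have [c /andP[c0 c1] low] := survives_lower.
have [C C1 upp] := survives_pair_upper.
have C0 : 0 < C by lra.
have del0 : 0 < c ^+ 2 / (64 * C) by rewrite divr_gt0 ?mulr_gt0 // exprn_gt0.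
exists (c ^+ 2 / (64 * C)) => // m h h0.
have [A [mA iA start]] := start_stages m h.
have A0 : (0 < A)%N by lia.
have /choice[D hD] : forall p : nat * nat, exists D, (i0 <= p.1 < p.2)%N -> forall N h,
    stage (scale p.1) M l (Y p.1) h = Some 0%N ->
    stage (scale p.2) M l (Y p.2) h = Some 0%N -> current h != 0 ->
    walk_sum N.+1
      (fun h => a (current h) * ((survives p.1 h)%:R * (survives p.2 h)%:R)) h <=
    C * (p.1%:R * (p.2%:R - p.1%:R))^-1 * a (current h) + D / N.+1%:R.
  move=> [i j] /=; case: (boolP (i0 <= i < j)%N) => [/upp[D hD]|_]; first by exists D.
  by exists 0.
(* The harmonic sum up to [n] is at least twice the part below [A]. *)
have [n An Hbig] := hsum_unbounded (2 * hsum R 1 A + 1) A.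
set H := hsum R 1 n in Hbig; set s := hsum R A n.
have sH : H / 2 <= s.
  by have := @hsum_cat R A n; rewrite A0 (ltnW An) -/H -/s => /(_ isT); lra.
have H1 : 1 <= H by have := hsum_ge0 R 1 A; lra.
(* Up to constants, this is the value of [t] that maximises the second moment bound. *)
pose t := c / (8 * C * H).
have CH : 1 <= C * H by nra.
have t0 : 0 < t by rewrite divr_gt0 // ?mulr_gt0 //; lra.
have t1 : t <= 1 by rewrite ler_pdivrMr ?mulr_gt0 //; lra.
pose Dsum := 2 * t ^+ 2 * \sum_(A <= j < n) \sum_(A <= i < j) D (i, j).
have ax := potential_kernel_ge R h0.
have [N0 hN0] : exists N0 : nat, `|Dsum| <= N0%:R * (c ^+ 2 / (64 * C) * (3 / 4)).
  have den0 : 0 < c ^+ 2 / (64 * C) * (3 / 4) by apply: mulr_gt0 => //; lra.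
  have := archi_boundP (divr_ge0 (normr_ge0 Dsum) (ltW den0)).
  by rewrite ltr_pdivrMr // => /ltW h1; exists (Num.bound (`|Dsum| / (c ^+ 2 / (64 * C) * (3 / 4)))).
exists A, n, N0.+1; split=> // -[//|N] NN.
have small : Dsum / N.+1%:R <= c ^+ 2 / (64 * C) * a (current h).
  move: (c ^+ 2 / (64 * C)) del0 hN0 => e e0 hN0.
  rewrite ler_pdivrMr ?ltr0n //; apply: le_trans (le_trans (ler_norm _) hN0) _.
  rewrite mulrC -!mulrA ler_wpM2l ?(ltW e0) //.
  rewrite [leLHS]mulrA; apply: (ler_pM _ (ler0n _ _) ax); first by rewrite divr_ge0.
  by rewrite ler_nat ltnW.
apply: le_trans (_ : walk_sum N.+1 (fun h =>
    t * (\sum_(A <= i < n) a (current h) * (survives i h)%:R)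
    + (- (2 * t ^+ 2)) * (\sum_(A <= j < n) \sum_(A <= i < j)
        a (current h) * ((survives i h)%:R * (survives j h)%:R))) h <= _); last first.
  apply: ler_walk_sumT => h1.
  have t01 : 0 <= t <= 1 by rewrite (ltW t0).
  have := second_moment_pointwise (survives ^~ h1) A n t01.
  rewrite -/(some_survives A n h1) -mulr_sumr.
  under [X in _ -> _ + _ * X <= _]eq_bigr do rewrite -mulr_sumr.
  rewrite -mulr_sumr; have := kernel_ge0 R (current h1).
  set S := \sum_(_ <= _ < _) _; set P := \sum_(_ <= _ < _) _.
  move=> a0 hh; apply: le_trans (ler_wpM2l a0 hh).
  by rewrite le_eqVlt; apply/orP; left; apply/eqP; ring.
rewrite walk_sumD !walk_sumZ !walk_sum_sum.
have lowS : c * s * a (current h) <=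
    \sum_(A <= i < n) walk_sum N.+1 (fun h => a (current h) * (survives i h)%:R) h.
  rewrite /s /hsum mulr_sumr mulr_suml; apply: ler_sum_nat => i /andP[Ai _].
  exact: (low i N.+1 h (leq_trans iA Ai) (start i Ai) h0).
have uppS : \sum_(A <= j < n) walk_sum N.+1 (fun h => \sum_(A <= i < j)
      a (current h) * ((survives i h)%:R * (survives j h)%:R)) h <=
    C * (2 * s * H) * a (current h)
      + (\sum_(A <= j < n) \sum_(A <= i < j) D (i, j)) / N.+1%:R.
  apply: le_trans (_ : \sum_(A <= j < n) \sum_(A <= i < j)
    (C * (i%:R * (j%:R - i%:R))^-1 * a (current h) + D (i, j) / N.+1%:R) <= _).
    apply: ler_sum_nat => j /andP[Aj _]; rewrite walk_sum_sum.
    apply: ler_sum_nat => i /andP[Ai ij].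
    have iij : (i0 <= i < j)%N by rewrite ij (leq_trans iA Ai).
    exact: (hD (i, j) iij N h (start i Ai) (start j Aj) h0).
  under eq_bigr do rewrite big_split /= -!mulr_suml -mulr_sumr.
  rewrite big_split /= -!mulr_suml -mulr_sumr lerD2r ler_wpM2r ?kernel_ge0 //.
  by rewrite ler_wpM2l ?hsum_pairs //; lra.
have step1 := ler_wpM2l (ltW t0) lowS.
have tt0 : 0 <= 2 * t ^+ 2 by rewrite mulr_ge0 ?sqr_ge0.
have step2 := ler_wpM2l tt0 uppS.
rewrite mulNr; apply: le_trans (lerB step1 step2).
have e1 : 2 * t ^+ 2 * (C * (2 * s * H) * a (current h)) =
    t * (c * s * a (current h)) / 2.
  by rewrite /t; field; rewrite !gt_eqF //; lra.
have e2 : c ^+ 2 / (32 * C) * a (current h) <= t * (c * s * a (current h)) / 2.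
  have -> : t * (c * s * a (current h)) / 2 = c ^+ 2 / (32 * C) * a (current h) * (2 * s / H).
    by rewrite /t; field; rewrite !gt_eqF //; lra.
  rewrite -[leLHS]mulr1 ler_wpM2l //; last by rewrite ler_pdivlMr; lra.
  by rewrite mulr_ge0 ?kernel_ge0 // divr_ge0 ?sqr_ge0 //; lra.
have e3 : c ^+ 2 / (32 * C) * a (current h) = 2 * (c ^+ 2 / (64 * C) * a (current h)).
  by field; rewrite gt_eqF.
rewrite mulrDr e1 (mulrA (2 * t ^+ 2) _ N.+1%:R^-1) -/Dsum.
rewrite e3 in e2.
move: small e2; set x1 := c ^+ 2 / _ * _; set x3 := t * _; set x4 := Dsum / _; lra.
Qed.

End ManyScales.

(** * Real-valued probabilities and sets of naturals *)

Section RealProbability.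
Context d (T : measurableType d) (R : realType) (P : probability T R).
Implicit Types (A : set T).

Definition pr A : R := fine (P A).

Lemma prE A : measurable A -> P A = (pr A)%:E.
Proof. by move=> mA; rewrite fineK // fin_num_measure. Qed.

Lemma pr_ge0 A : 0 <= pr A.
Proof. by rewrite fine_ge0. Qed.

Lemma pr0 : pr set0 = 0.
Proof. by rewrite /pr measure0. Qed.

Lemma le_pr A A' : measurable A -> measurable A' -> A `<=` A' -> pr A <= pr A'.
Proof.
by move=> mA mA' AA'; rewrite -lee_fin -!prE //; apply: le_measure; rewrite ?inE.
Qed.

Lemma pr_setDI A A' : measurable A -> measurable A' ->
  pr A = pr (A `\` A') + pr (A `&` A').
Proof.
move=> mA mA'; apply/EFin_inj; rewrite EFinD -!prE //.
- by rewrite -measureDI.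
- exact: measurableI.
- exact: measurableD.
Qed.

Lemma pr_bigcup_le (F : (set T)^nat) (c : R) N0 : (forall n, measurable (F n)) ->
  {homo F : n m / (n <= m)%N >-> n `<=` m} ->
  (forall n, (N0 <= n)%N -> pr (F n) <= c) -> pr (\bigcup_n F n) <= c.
Proof.
move=> mF ndF Fc; rewrite -lee_fin -prE; last exact: bigcup_measurable.
have cv : (P \o F) n @[n --> \oo] --> P (\bigcup_n F n).
  apply: nondecreasing_cvg_mu => //; first exact: bigcup_measurable.
  by move=> n m nm; apply/subsetPset; exact: ndF.
rewrite -(cvg_lim _ cv) //; apply: lime_le; first by apply/cvg_ex; exists (P (\bigcup_n F n)).
near=> n; rewrite /= prE // lee_fin Fc //; near: n; exact: nbhs_infty_ge.
Unshelve. all: end_near. Qed.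

Lemma pr_bigcap_ge (F : (set T)^nat) (c : R) : (forall n, measurable (F n)) ->
  {homo F : n m / (n <= m)%N >-> m `<=` n} ->
  (forall n, c <= pr (F n)) -> c <= pr (\bigcap_n F n).
Proof.
move=> mF ndF Fc; rewrite -lee_fin -prE; last exact: bigcap_measurable.
have cv : (P \o F) n @[n --> \oo] --> P (\bigcap_n F n).
  apply: nonincreasing_cvg_mu => //; first exact: le_lt_trans (probability_le1 P (mF 0%N)) (ltry 1).
    exact: bigcap_measurable.
  by move=> n m nm; apply/subsetPset; exact: ndF.
rewrite -(cvg_lim _ cv) //; apply: lime_ge; first by apply/cvg_ex; exists (P (\bigcap_n F n)).
by near=> n; rewrite /= prE // lee_fin.
Unshelve. all: end_near. Qed.

Lemma pr_sum_le n (F : 'I_n -> set T) A : measurable A ->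
  (forall i, measurable (F i)) -> trivIset setT F -> (forall i, F i `<=` A) ->
  \sum_i pr (F i) <= pr A.
Proof.
move=> mA mF tF FA; rewrite -lee_fin -(prE mA) -sumEFin.
under eq_bigr do rewrite -prE //.
rewrite -measure_bigsetU_ord //; apply: le_measure; rewrite ?inE //.
  by apply: bigsetU_measurable.
by apply: (big_ind (fun X => X `<=` A)) => [w []|X Y XA YA w []|i _]; [exact: XA|exact: YA|exact: FA].
Qed.

(** A countable partition into the level sets of [f] localises an inequality
    between two probabilities. *)
Lemma pr_fibers_le (K : countType) (f : T -> K) (D : K -> Prop) A (c : R) :
  (forall v, measurable [set w | f w = v]) -> measurable A -> 0 <= c ->
  (forall v, D v -> pr (A `&` [set w | f w = v]) <= c * pr [set w | f w = v]) ->
  pr (A `&` [set w | D (f w)]) <= c * pr [set w | D (f w)].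
Proof.
move=> mf mA c0 H.
pose F i := [set w | D (f w) /\ pickle (f w) = i].
have FE i : F i = if unpickle i is Some v then
    if pselect (D v /\ pickle v = i) then [set w | f w = v] else set0 else set0.
  apply/seteqP; split=> w; rewrite /F /=.
    by move=> [Dw <-]; rewrite pickleK; case: pselect => //= -[]; split.
  case: (unpickle i) => [v|//]; case: pselect => [[Dv vi]|//] /= ->; by split.
have mF i : measurable (F i).
  by rewrite FE; case: (unpickle i) => [v|]; [case: pselect => ?; [exact: mf|]|]; exact: measurable0.
have tF : trivIset setT F by move=> i j _ _ [w [[_ <-] [_ <-]]].
have UF : \bigcup_i F i = [set w | D (f w)].
  by apply/seteqP; split=> [w [i _ [Dw _]]//|w Dw]; exists (pickle (f w)).
have mU : measurable [set w | D (f w)] by rewrite -UF; exact: bigcup_measurable.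
rewrite -lee_fin EFinM -!prE //; last exact: measurableI.
rewrite -UF setI_bigcupr measure_semi_bigcup //; last first.
- by rewrite -setI_bigcupr UF; exact: measurableI.
- by apply: trivIset_setIl.
- by move=> i; exact: measurableI.
rewrite measure_semi_bigcup //; last exact: bigcup_measurable.
rewrite -nneseriesZl //; apply: lee_nneseries => // i _.
have mAF : measurable (A `&` F i) by exact: measurableI.
suff : (P (A `&` F i) <= c%:E * P (F i))%E by [].
rewrite (prE mAF) (prE (mF i)) -EFinM lee_fin.
rewrite FE; case: (unpickle i) => [v|]; last by rewrite setI0 pr0 mulr0.
case: pselect => [[Dv ?]|?]; last by rewrite setI0 pr0 mulr0.
exact: H.
Qed.

End RealProbability.

Section InfiniteNat.

Lemma infinite_natP (A : set nat) :
  infinite_set A <-> forall m, exists2 n, (m <= n)%N & A n.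
Proof.
split=> [iA m|H /finite_seqP[s As]].
  apply: contrapT => H; apply: iA; apply: (@sub_finite_set _ _ `I_m); last exact: finite_II.
  by move=> n An /=; rewrite ltnNge; apply/negP => mn; apply: H; exists n.
have [n ns An] := H (\max_(i <- s) i).+1.
have ins : n \in s by move: An; rewrite As.
by have := @leq_bigmax_seq _ s xpredT id n ins isT; rewrite leqNgt ns.
Qed.

End InfiniteNat.

(** * Law of the history of the conditioned walk *)

Section ChainHistory.
Context (R : realType) d (T : measurableType d) (P : probability T R).
Variables (x0 : Z2_star) (X : nat -> T -> Z2_star).
Hypothesis hX : markov_chain P (@conditioned_trans R) x0 X.
Implicit Types (h : seq Z2) (w : T).
Local Notation a := (potential_kernel R).

Fixpoint history n w : seq Z2 :=
  if n is m.+1 then val (X n w) :: history m w else [:: val (X 0 w)].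

Definition history_at n h : set T := [set w | history n w = h].

Lemma current_history n w : current (history n w) = val (X n w).
Proof. by case: n. Qed.

Lemma historyP n w w' :
  history n w = history n w' <-> forall k, (k <= n)%N -> X k w = X k w'.
Proof.
split.
  elim: n => [[] /val_inj e k|n IH [] /val_inj e /IH hn k].
    by rewrite leqn0 => /eqP ->.
  by rewrite leq_eqVlt => /predU1P[->//|]; rewrite ltnS; exact: hn.
elim: n => [|n IH] e /=; first by rewrite e.
by rewrite e // IH // => k kn; apply: e; exact: leqW.
Qed.

Lemma measurable_position n (x : Z2) : measurable [set w | val (X n w) = x].
Proof.
have [mX _ _] := hX; have [->|x0'] := eqVneq x 0.
  rewrite (_ : [set _ | _] = set0); first exact: measurable0.
  by apply/seteqP; split=> w //= h; have /negP[] := valP (X n w); apply/eqP.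
rewrite (_ : [set _ | _] = [set w | X n w = exist _ x x0']); first exact: mX.
by apply/seteqP; split=> w /= => [h|->//]; exact: val_inj.
Qed.

Lemma measurable_history_at n h : measurable (history_at n h).
Proof.
rewrite /history_at; elim: n h => [|n IH] [|x h] /=.
- by rewrite (_ : [set _ | _] = set0); [exact: measurable0|apply/seteqP; split].
- case: h => [|y h].
    rewrite (_ : [set _ | _] = [set w | val (X 0 w) = x]); first exact: measurable_position.
    by apply/seteqP; split=> w /= => [[]|->].
  by rewrite (_ : [set _ | _] = set0); [exact: measurable0|apply/seteqP; split].
- by rewrite (_ : [set _ | _] = set0); [exact: measurable0|apply/seteqP; split].
rewrite (_ : [set _ | _] = [set w | val (X n.+1 w) = x] `&` [set w | history n w = h]).
  by apply: measurableI; [exact: measurable_position|exact: IH].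
by apply/seteqP; split=> w /= => [[]|[-> ->]].
Qed.

Lemma measurable_history n (D : seq Z2 -> Prop) : measurable [set w | D (history n w)].
Proof.
pose F (o : option (seq Z2)) :=
  if o is Some h then if pselect (D h) then history_at n h else set0 else set0.
have mF o : measurable (F o).
  case: o => [h|] /=; last exact: measurable0.
  by case: pselect => ?; [exact: measurable_history_at|exact: measurable0].
rewrite (_ : [set _ | _] = \bigcup_i F (unpickle i)); first exact: bigcup_measurable.
apply/seteqP; split=> w.
  by move=> Dw; exists (pickle (history n w)) => //; rewrite pickleK /=; case: pselect.
by move=> [i _]; case: (unpickle i) => [h|//] /=; case: pselect => //= Dh ->.
Qed.

Lemma history_at_zero n h : current h = 0 -> history_at n h = set0.
Proof.
move=> h0; apply/seteqP; split=> w //= e.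
by have /negP[] := valP (X n w); apply/eqP; rewrite -current_history e.
Qed.

Lemma nn_step (x : Z2) (e : 'I_4) : nn x (x + step e).
Proof. by case: x => u v; case: e => -[|[|[|[|//]]]] he; rewrite /nn /step /=; lia. Qed.

(** The Markov property, stated along a fixed path that realises the history
    [h]. *)
Lemma pr_history_step n h (e : 'I_4) : current h + step e != 0 ->
  pr P (history_at n.+1 (current h + step e :: h)) =
  pr P (history_at n h) * (a (current h + step e) / (4 * a (current h))).
Proof.
move=> y0; have [e0|/set0P[w0 hw0]] := eqVneq (history_at n h) set0.
  rewrite e0 pr0 mul0r (_ : history_at _ _ = set0) ?pr0 //.
  by apply/seteqP; split=> w //= -[_ hw]; have : set0 w by rewrite -e0.
pose y : Z2_star := exist _ (current h + step e) y0.
have [_ _ /(_ n (fun k => if (k <= n)%N then X k w0 else y))] := hX.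
rewrite ltnn leqnn.
have -> : [set w | forall k, (k <= n)%N -> X k w = if (k <= n)%N then X k w0 else y] =
    history_at n h.
  apply/seteqP; split=> w /= hw.
    by rewrite /history_at /= -hw0; apply/historyP => k kn; rewrite hw // kn.
  by move=> k kn; rewrite kn; move: hw; rewrite /history_at /= -hw0 => /historyP; exact.
have -> : [set w | forall k, (k <= n.+1)%N -> X k w = if (k <= n)%N then X k w0 else y] =
    history_at n.+1 (current h + step e :: h).
  apply/seteqP; split=> w /=.
    move=> hw; rewrite /history_at /=; congr cons.
      by have := hw n.+1 (leqnn _); rewrite ltnn => ->.
    by rewrite -hw0; apply/historyP => k kn; rewrite hw ?kn // leqW.
  rewrite /history_at /= => -[hy hh] k; rewrite leq_eqVlt => /predU1P[->|].
    by rewrite ltnn; exact: val_inj.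
  by rewrite ltnS => kn; rewrite kn; move: hh; rewrite -hw0 => /historyP; exact.
rewrite (prE P (measurable_history_at n.+1 _)) (prE P (measurable_history_at n h)) -EFinM.
move=> [->]; congr (_ * _); rewrite /conditioned_trans /=.
have -> : val (X n w0) = current h by rewrite -current_history hw0.
by rewrite nn_step.
Qed.

Lemma step_inj : injective step.
Proof.
by move=> -[[|[|[|[|//]]]] h1] -[[|[|[|[|//]]]] h2] //= _; apply: val_inj.
Qed.

(** The conditioned walk is the walk killed at the origin reweighted by the
    ratio of the potential kernel at the two ends of the path. *)
Lemma pr_history_ge n N h (D : seq Z2 -> bool) :
  pr P (history_at n h) *
    (walk_sum N (fun h => a (current h) * (D h)%:R) h / a (current h)) <=
  pr P (history_at n h `&` [set w | D (history (n + N) w)]).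
Proof.
have mD m : measurable [set w | D (history m w)] by exact: (measurable_history m D).
have [h0|h0] := eqVneq (current h) 0.
  by rewrite history_at_zero // set0I pr0 mul0r.
elim: N n h h0 => [|N IH] n h h0 /=.
  have := potential_kernel_ge R h0 => a34.
  rewrite mulrAC divff ?mul1r; last by lra.
  rewrite addn0; case: (boolP (D h)) => Dh; last by rewrite mulr0 pr_ge0.
  rewrite mulr1 (_ : _ `&` _ = history_at n h) //.
  by apply/seteqP; split=> [w []//|w hw]; split=> //=; rewrite hw.
have a34 := potential_kernel_ge R h0.
pose F e := if current h + step e == 0 then set0 else
  history_at n.+1 (current h + step e :: h) `&` [set w | D (history (n + N.+1) w)].
apply: le_trans (_ : \sum_(e < 4) pr P (F e) <= _); last first.
  apply: pr_sum_le => [|e|e e' _ _ [w []]|e w].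
  - by apply: measurableI => //; exact: measurable_history_at.
  - rewrite /F; case: ifP => _; first exact: measurable0.
    by apply: measurableI => //; exact: measurable_history_at.
  - rewrite /F; case: ifP => _ // -[h1 _]; case: ifP => _ // -[h2 _].
    move: h1 h2; rewrite /history_at /= => -[h1 _] [h2 _].
    by apply: step_inj; apply: (addrI (current h)); rewrite -h1 -h2.
  - by rewrite /F; case: ifP => // _ [[_ hw] Dw].
rewrite /killed_mean; set u := \sum_(e < 4) _.
rewrite (_ : _ * _ = pr P (history_at n h) / (4 * a (current h)) * u); last first.
  by move: (pr _ _) (u) => p v; field; rewrite gt_eqF //; lra.
rewrite /u mulr_sumr; apply: ler_sum => e _.
rewrite /F; case: ifPn => y0; first by rewrite pr0 mulr0.
have := IH n.+1 (current h + step e :: h) y0; rewrite addSnnS => IHe.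
apply: le_trans IHe; rewrite pr_history_step //=.
have y34 := potential_kernel_ge R y0.
rewrite le_eqVlt; apply/orP; left; apply/eqP.
by field; rewrite !gt_eqF //; lra.
Qed.

End ChainHistory.

(** * Almost sure success at infinitely many scales *)

Section AlmostSure.
Context (R : realType) d (T : measurableType d) (P : probability T R).
Variables (x0 : Z2_star) (X : nat -> T -> Z2_star).
Hypothesis hX : markov_chain P (@conditioned_trans R) x0 X.
Variables (M l B i0 : nat) (Y : nat -> nat -> Z2).
Hypothesis i0_gt0 : (0 < i0)%N.
Hypothesis cor : forall i, (i0 <= i)%N -> corridor (scale B i) M l B (Y i).
Hypothesis scale_large :
  forall i, (i0 <= i)%N -> 108 * B%:R + 432 <= level R (scale B i).
Local Notation a := (potential_kernel R).
Local Notation surv := (survives M l B Y).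
Local Notation hist := (history X).

Lemma survives_cons i x h : surv i (x :: h) -> surv i h.
Proof. by rewrite /survives /=; case: (stage _ _ _ _ h). Qed.

Lemma survives_history_mono i N N' w : (N <= N')%N ->
  surv i (hist N' w) -> surv i (hist N w).
Proof.
move=> /subnK <-; elim: (N' - N)%N => [//|k IH].
by rewrite addSn => /= /survives_cons.
Qed.

Definition all_fail A n N : set T :=
  [set w | ~~ some_survives M l B Y A n (hist N w)].

(** The complement of success at infinitely many scales is the union of these
    events over [m]. *)
Definition eventually_fail m : set T :=
  [set w | forall i, (m <= i)%N -> exists N, ~~ surv i (hist N w)].

Lemma measurable_all_fail A n N : measurable (all_fail A n N).
Proof. exact: (measurable_history hX N (fun h => ~~ some_survives M l B Y A n h)). Qed.

Lemma all_fail_mono A n N N' : (N <= N')%N -> all_fail A n N `<=` all_fail A n N'.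
Proof.
move=> NN w /hasPn hw; apply/hasPn => i hi; apply: contra (hw i hi).
exact: survives_history_mono.
Qed.

Lemma bigcup_all_failP A n w : (\bigcup_N all_fail A n N) w <->
  forall i, (A <= i < n)%N -> exists N, ~~ surv i (hist N w).
Proof.
split=> [[N _ /hasPn hw] i hi|H].
  by exists N; apply: hw; rewrite mem_index_iota.
have /choice[N hN] : forall i, exists N, (A <= i < n)%N -> ~~ surv i (hist N w).
  move=> i; case: (boolP (A <= i < n)%N) => [/H[N hN]|_]; first by exists N.
  by exists 0%N.
exists (\max_(i <- index_iota A n) N i) => //; apply/hasPn => i ii.
have hi : (A <= i < n)%N by rewrite -mem_index_iota.
by apply: contra (hN i hi); apply: survives_history_mono; exact: leq_bigmax_seq.
Qed.

Lemma bigcap_bigcup_all_fail m :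
  \bigcap_n \bigcup_N all_fail m n N = eventually_fail m.
Proof.
apply/seteqP; split=> w hw.
  move=> i mi; have /bigcup_all_failP := hw i.+1 I.
  by apply; rewrite mi ltnSn.
by move=> n _; apply/bigcup_all_failP => i /andP[mi _]; exact: hw.
Qed.

Lemma measurable_bigcup_all_fail m n : measurable (\bigcup_N all_fail m n N).
Proof. by apply: bigcup_measurable => N _; exact: measurable_all_fail. Qed.

Lemma measurable_eventually_fail m : measurable (eventually_fail m).
Proof.
rewrite -bigcap_bigcup_all_fail; apply: bigcap_measurable => //.
by move=> n _; exact: measurable_bigcup_all_fail.
Qed.

(** Whatever the past, a success at a scale beyond [m] has conditional
    probability at least [delta]. *)
Lemma eventually_fail_history_le : exists2 delta : R, 0 < delta < 1 & forall m n h,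
  pr P (eventually_fail m `&` history_at X n h) <=
  (1 - delta) * pr P (history_at X n h).
Proof.
have [delta d0 low] := some_survives_lower i0_gt0 cor scale_large.
exists (Num.min delta 2^-1); first by rewrite lt_min d0 gt_min /=; lra.
move=> m n h; have [h0|h0] := eqVneq (current h) 0.
  by rewrite history_at_zero // setI0 pr0 mulr0.
have a34 := potential_kernel_ge R h0.
have [A [k [N0 [mA lowN]]]] := low m h h0.
have mH := measurable_history_at hX n h.
apply: le_trans (_ : pr P (\bigcup_N (history_at X n h `&` all_fail A k (n + N))) <= _).
  apply: le_pr.
  - by apply: measurableI => //; exact: measurable_eventually_fail.
  - apply: bigcup_measurable => N _; apply: measurableI => //.
    exact: measurable_all_fail.
  move=> w [hw Hw]; have : (\bigcup_N all_fail A k N) w.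
    by apply/bigcup_all_failP => i /andP[Ai _]; apply: hw; exact: leq_trans Ai.
  move=> [N _ wN]; exists N => //; split=> //.
  by apply: all_fail_mono wN; exact: leq_addl.
apply: (pr_bigcup_le (N0 := N0)).
- by move=> N; apply: measurableI => //; exact: measurable_all_fail.
- by move=> N N' NN; apply: setIS; apply: all_fail_mono; rewrite leq_add2l.
move=> N NN0.
have mS : measurable [set w | some_survives M l B Y A k (hist (n + N) w)].
  exact: (measurable_history hX _ (fun h => some_survives M l B Y A k h)).
have := pr_history_ge hX n N h (some_survives M l B Y A k).
have := pr_setDI P mH mS.
have -> : history_at X n h `\` [set w | some_survives M l B Y A k (hist (n + N) w)] =
    history_at X n h `&` all_fail A k (n + N).
  by apply/seteqP; split=> w [? /negP].
have hp := pr_ge0 P (history_at X n h).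
have := lowN N NN0; rewrite -ler_pdivlMr; last by lra.
move: (walk_sum _ _ _ / _) (pr P (_ `&` _)) (pr P (_ `&` _)) => W p1 p2 hW e1 e2.
have : Num.min delta 2^-1 <= W by apply: le_trans hW; rewrite ge_min lexx.
nra.
Qed.

(** The event is a decreasing limit of increasing limits of events that depend
    on finitely many positions. Conditioning on the latter,
    [eventually_fail_history_le] gives [p <= (1 - delta) * p] for its
    probability [p]. *)
Lemma eventually_fail_null m : P (eventually_fail m) = 0%E.
Proof.
have [delta /andP[d0 d1] H] := eventually_fail_history_le.
have mE := measurable_eventually_fail m.
rewrite prE //; congr EFin.
suff : pr P (eventually_fail m) <= (1 - delta) * pr P (eventually_fail m).
  by have := pr_ge0 P (eventually_fail m); nra.
have c0 : 0 < 1 - delta by lra.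
rewrite mulrC -ler_pdivrMr // -[in leRHS]bigcap_bigcup_all_fail.
apply: pr_bigcap_ge => [n|n n' nn w|n].
- exact: measurable_bigcup_all_fail.
- by move=> /bigcup_all_failP hw; apply/bigcup_all_failP => i ?; apply: hw; lia.
rewrite ler_pdivrMr // mulrC.
have EO : eventually_fail m = \bigcup_N (eventually_fail m `&` all_fail m n N).
  rewrite -setI_bigcupr; apply/esym/setIidPl => w hw; apply/bigcup_all_failP.
  by move=> i /andP[mi _]; exact: hw.
rewrite {1}EO; apply: (pr_bigcup_le (N0 := 0%N)) => [N|N N' NN|N _].
- by apply: measurableI => //; exact: measurable_all_fail.
- by apply: setIS; exact: all_fail_mono.
apply: le_trans (_ : (1 - delta) * pr P (all_fail m n N) <= _).
  apply: (pr_fibers_le (f := hist N) (D := fun h => ~~ some_survives M l B Y m n h)) => //.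
  - by move=> h; exact: (measurable_history_at hX N h).
  - by rewrite ltW.
  - by move=> h _; exact: H.
rewrite ler_pM2l //; apply: le_pr.
- exact: measurable_all_fail.
- exact: measurable_bigcup_all_fail.
- by move=> w hw; exists N.
Qed.

End AlmostSure.

(** * Chains of points that stay away from the set *)

Section PlaneNorms.
Variable R : realType.
Implicit Types (v w : R * R).

Definition norm1 v : R := `|v.1| + `|v.2|.
Definition mulp (c : R) v : R * R := (c * v.1, c * v.2).

Lemma norm1D v w : norm1 (v + w) <= norm1 v + norm1 w.
Proof.
by rewrite /norm1 /= addrACA lerD // ler_normD.
Qed.

Lemma norm1N v : norm1 (- v) = norm1 v.
Proof. by rewrite /norm1 /= !normrN. Qed.

Lemma norm1_triangle u v w : norm1 (v - w) <= norm1 (v - u) + norm1 (u - w).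
Proof. by have := norm1D (v - u) (u - w); rewrite addrA subrK. Qed.

Lemma norm1_mulp c v w : 0 <= c -> norm1 (mulp c v - mulp c w) = c * norm1 (v - w).
Proof. by move=> c0; rewrite /norm1 /= -!mulrBr !normrM (ger0_norm c0) -mulrDr. Qed.

Lemma enorm_ge0 v : 0 <= enorm v.
Proof. exact: sqrtr_ge0. Qed.

Lemma enorm_le_norm1 v : enorm v <= norm1 v.
Proof.
rewrite /enorm -(@ger0_norm _ (norm1 v)) ?addr_ge0 // -sqrtr_sqr ler_wsqrtr //.
rewrite /norm1 sqrrD !real_normK ?num_real //.
have := normr_ge0 v.1; have := normr_ge0 v.2; nra.
Qed.

Lemma norm1_le_enorm v : norm1 v <= 2 * enorm v.
Proof.
have h (a b : R) : `|a| <= Num.sqrt (a ^+ 2 + b ^+ 2).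
  by rewrite -sqrtr_sqr ler_wsqrtr // lerDl sqr_ge0.
by have := h v.1 v.2; have := h v.2 v.1; rewrite /norm1 /enorm (addrC (v.2 ^+ 2)); lra.
Qed.

Lemma enorm_mulp c v : 0 <= c -> enorm (mulp c v) = c * enorm v.
Proof.
move=> c0; rewrite /enorm /= !exprMn -mulrDr sqrtrM ?sqr_ge0 //.
by rewrite sqrtr_sqr ger0_norm.
Qed.

Lemma l1normE (x : Z2) : (l1norm x)%:R = norm1 (Z2_to_R2 R x).
Proof. by rewrite /l1norm natrD !natr_absz !intr_norm. Qed.

Lemma Z2_to_R2B (x y : Z2) : Z2_to_R2 R (x - y) = Z2_to_R2 R x - Z2_to_R2 R y.
Proof. by case: x y => [u v] [u' v']; rewrite /Z2_to_R2 /= !rmorphB. Qed.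

Definition round v : Z2 := (Num.floor v.1, Num.floor v.2).

Lemma round_near v : norm1 (v - Z2_to_R2 R (round v)) <= 2.
Proof.
have h (r : R) : `|r - (Num.floor r)%:~R| <= 1.
  have := floor_le r; have := lt_succ_floor r; rewrite intrD1 => h1 h2.
  by rewrite ger0_norm; lra.
by have := h v.1; have := h v.2; rewrite /norm1 /=; lra.
Qed.

Lemma l1norm_round_le v w :
  (l1norm (round v - round w))%:R <= norm1 (v - w) + 4.
Proof.
rewrite l1normE Z2_to_R2B; have := round_near v; have := round_near w.
have := norm1_triangle v (Z2_to_R2 R (round v)) (Z2_to_R2 R (round w)).
have := norm1_triangle w v (Z2_to_R2 R (round w)).
rewrite -(norm1N (_ - v)) opprB; lra.
Qed.

Lemma l1norm_round_bounds v :
  norm1 v - 2 <= (l1norm (round v))%:R <= norm1 v + 2.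
Proof.
rewrite l1normE; have := round_near v; set x := Z2_to_R2 R _.
have := norm1D (v - x) x; rewrite subrK.
have := norm1D v (- (v - x)); rewrite norm1N opprB addrC subrK; lra.
Qed.

End PlaneNorms.

Section Reach.
Variables (R : realType) (G : set (R * R)) (c3 eta : R).
Implicit Types (v w : R * R).

Definition clear v := forall y, G y -> c3 <= enorm (v - y).

Definition reach v := exists m (z : nat -> R * R), [/\ z 0%N = 0, z m = v,
  forall j, (j < m)%N -> norm1 (z j.+1 - z j) <= eta &
  forall j, (j <= m)%N -> clear (z j)].

Lemma reach0 : clear 0 -> reach 0.
Proof. by move=> c0; exists 0%N, (fun=> 0); split. Qed.

Lemma reach_step v w : reach v -> norm1 (w - v) <= eta -> clear w -> reach w.
Proof.
move=> [m [z [z0 zm zs zc]]] vw cw.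
exists m.+1, (fun j => if (j <= m)%N then z j else w); split=> //=.
- by rewrite ltnn.
- move=> j; rewrite ltnS leq_eqVlt => /predU1P[->|jm].
    by rewrite ltnn eqxx zm.
  by rewrite jm orbT; exact: zs.
- by move=> j _; case: ifP => // jm; exact: zc.
Qed.

Lemma is_derive01_near (f : R -> R) s l e : is_derive01 f s l -> 0 < e ->
  exists2 dl : R, 0 < dl & forall t, 0 <= t <= 1 -> `|t - s| < dl -> `|f t - f s| <= e.
Proof.
move=> fs e0; have /cvgrPdist_lt/(_ 1 ltr01) := fs.
rewrite /prop_near1 /within /= => /nbhs_ballP[dl /= dl0 H].
have l1 : 0 < `|l| + 1 by rewrite ltr_wpDl.
exists (Num.min dl (e / (`|l| + 1))); first by rewrite lt_min dl0 divr_gt0.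
move=> t t01; rewrite lt_min => /andP[tdl te].
have [->|ts] := eqVneq t s; first by rewrite subrr normr0 ltW.
have := H t; rewrite /ball /= distrC => /(_ tdl ts).
rewrite in_itv /= => /(_ t01) hl.
have ts0 : 0 < `|t - s| by rewrite normr_gt0 subr_eq0.
have : `|(f t - f s) / (t - s)| <= `|l| + 1.
  have := ler_normB l (l - (f t - f s) / (t - s)); rewrite opprB addrC subrK.
  by lra.
rewrite normrM normfV ler_pdivrMr // => h; apply: le_trans h _.
by rewrite mulrC -ler_pdivlMr // ltW.
Qed.

(** Consider the supremum of the parameters whose points are reachable: by
    continuity it is itself such a parameter, and it cannot be smaller than 1.
    *)
Lemma reach_path (f1 f2 df1 df2 : R -> R) : 0 < eta ->
  (f1 0, f2 0) = (0, 0) ->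
  (forall s, 0 <= s <= 1 -> is_derive01 f1 s (df1 s) /\ is_derive01 f2 s (df2 s)) ->
  (forall s, 0 <= s <= 1 -> clear (f1 s, f2 s)) ->
  reach (f1 1, f2 1).
Proof.
move=> eta0 f0 fd fc; pose f s := (f1 s, f2 s).
have cont s : 0 <= s <= 1 -> exists2 dl : R, 0 < dl &
    forall t, 0 <= t <= 1 -> `|t - s| < dl -> norm1 (f t - f s) <= eta / 2.
  move=> s01; have [h1 h2] := fd s s01; have e4 : 0 < eta / 4 by rewrite divr_gt0.
  have [d1 d10 H1] := is_derive01_near h1 e4; have [d2 d20 H2] := is_derive01_near h2 e4.
  exists (Num.min d1 d2); first by rewrite lt_min d10.
  move=> t t01; rewrite lt_min => /andP[td1 td2].
  by have := H1 t t01 td1; have := H2 t t01 td2; rewrite /norm1 /=; lra.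
pose E := [set s | 0 <= s <= 1 /\ reach (f s)].
have E0 : E 0.
  split; first by rewrite lexx ler01.
  rewrite /f f0; apply: reach0; have := fc 0; rewrite f0; apply.
  by rewrite lexx ler01.
have supE : has_sup E by split; [exists 0|exists 1 => s [/andP[_ ?] _]].
pose s := sup E.
have s01 : 0 <= s <= 1.
  apply/andP; split; first by apply: ub_le_sup => //; case: supE.
  by apply: ge_sup => [|t [/andP[_ ?] _]] //; exists 0.
have [dl dl0 Hs] := cont s s01.
have [t [t01 rt] ts] := sup_adherent dl0 supE.
have tles : t <= s by apply: ub_le_sup => //; case: supE.
have tdl : `|t - s| < dl by rewrite distrC ger0_norm ?subr_ge0 //; move: ts; rewrite -/s; lra.
have rs u : 0 <= u <= 1 -> `|u - s| < dl -> reach (f u).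
  move=> u01 us; apply: reach_step rt _ (fc u u01).
  have := norm1_triangle (f s) (f u) (f t); have := Hs u u01 us; have := Hs t t01 tdl.
  rewrite -(norm1N (f s - f t)) opprB; lra.
have [s1|s1] := ltP s 1; last first.
  have <- : s = 1 by apply/eqP; rewrite eq_le s1; case/andP: s01 => _ ->.
  by apply: rs => //; rewrite subrr normr0.
pose u := Num.min 1 (s + dl / 2).
have su : s < u by rewrite lt_min s1 ltrDl divr_gt0.
have u01 : 0 <= u <= 1 by rewrite ge_min lexx andbT; move: s01 su; lra.
have : E u.
  split=> //; apply: rs => //; rewrite ger0_norm ?subr_ge0 ?ltW //.
  have : u <= s + dl / 2 by rewrite ge_min lexx orbT.
  lra.
move=> /(ub_le_sup (proj2 supE)); rewrite -/s; lra.
Qed.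

(** The set lies in the disc of radius [c1] and [v] on its boundary. Moving
    from [v] radially outwards increases the distance to every point of the
    disc. *)
Lemma reach_radial v c1 : 0 < eta -> 0 < c1 -> enorm v = c1 ->
  (forall y, G y -> enorm y <= c1) -> reach v ->
  forall C : R, exists2 w, reach w & C <= norm1 w.
Proof.
move=> eta0 c10 vc1 Gc1 rv C.
have v2 : v.1 ^+ 2 + v.2 ^+ 2 = c1 ^+ 2.
  by rewrite -vc1 sqr_sqrtr // addr_ge0 ?sqr_ge0.
have cv : clear v by case: rv => m [z [_ <- _]]; apply.
have n1v : 0 < norm1 v by apply: lt_le_trans (enorm_le_norm1 v); rewrite vc1.
have clearM c : 1 <= c -> clear (mulp c v).
  move=> c1' y Gy; apply: le_trans (cv y Gy) _; rewrite /enorm ler_wsqrtr //=.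
  have : y.1 ^+ 2 + y.2 ^+ 2 <= c1 ^+ 2.
    have := Gc1 y Gy; rewrite -(@ler_pXn2r _ 2) ?nnegrE ?enorm_ge0 ?(ltW c10) //.
    by rewrite sqr_sqrtr // addr_ge0 ?sqr_ge0.
  have := sqr_ge0 (v.1 - y.1); have := sqr_ge0 (v.2 - y.2).
  set p := v.1 * y.1 + v.2 * y.2 => s2 s1 y2.
  have pc : p <= c1 ^+ 2 by rewrite /p; lra.
  have -> : (c * v.1 - y.1) ^+ 2 + (c * v.2 - y.2) ^+ 2 =
      (v.1 - y.1) ^+ 2 + (v.2 - y.2) ^+ 2 + (c - 1) * ((c + 1) * c1 ^+ 2 - 2 * p).
    by rewrite -v2 /p; ring.
  rewrite lerDl mulr_ge0 ?subr_ge0 //; have := sqr_ge0 c1; nra.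
pose tau := eta / norm1 v.
have tau0 : 0 < tau by rewrite divr_gt0.
have reachM j : reach (mulp (1 + tau * j%:R) v).
  elim: j => [|j IH].
    by rewrite mulr0 addr0 /mulp !mul1r -surjective_pairing.
  apply: reach_step IH _ (clearM _ _); last by rewrite lerDl mulr_ge0 ?ltW.
  rewrite (_ : _ - _ = mulp tau v - mulp tau 0).
    by rewrite (norm1_mulp _ _ (ltW tau0)) subr0 /tau divfK ?gt_eqF.
  rewrite /mulp -(natr1 j); apply/eqP; rewrite xpair_eqE /=.
  by apply/andP; split; apply/eqP; ring.
exists (mulp (1 + tau * (Num.bound (`|C| / eta))%:R) v); first exact: reachM.
have := archi_boundP (_ : 0 <= `|C| / eta).
rewrite divr_ge0 ?(ltW eta0) // => /(_ isT); set j := Num.bound _.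
rewrite ltr_pdivrMr // => hC.
have -> : norm1 (mulp (1 + tau * j%:R) v) = norm1 v + j%:R * eta.
  rewrite (_ : mulp _ v = mulp (1 + tau * j%:R) v - mulp (1 + tau * j%:R) 0).
    have p0 : 0 <= 1 + tau * j%:R by rewrite addr_ge0 // mulr_ge0 // ltW.
    rewrite (norm1_mulp _ _ p0) subr0 /tau.
    by field; rewrite lt0r_neq0.
  by rewrite /mulp /= !mulr0 subr0.
by have := ler_norm C; lra.
Qed.

End Reach.

(** * Corridors from a path that escapes the set *)

Section CorridorOfPath.
Variable R : realType.
Implicit Types (v w : R * R).

Lemma exp2_unbounded (C : R) : exists n, C <= 2 ^+ n.
Proof.
exists (Num.bound `|C|); apply: le_trans (ler_norm C) _.
apply: le_trans (ltW (archi_boundP (normr_ge0 C))) _.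
by rewrite -natrX ler_nat ltnW // ltn_expl.
Qed.

Lemma norm1_mulp0 c v : 0 <= c -> norm1 (mulp c v) = c * norm1 v.
Proof.
by move=> c0; rewrite /norm1 /= !normrM (ger0_norm c0) -mulrDr.
Qed.

Lemma mulpB c v w : mulp c v - mulp c w = mulp c (v - w).
Proof. by rewrite /mulp /=; congr pair; rewrite mulrBr. Qed.

Lemma enorm_sub0 v : enorm (0 - v) = enorm v.
Proof. by rewrite /enorm /= !sub0r !sqrrN. Qed.

(** The dilation factor is [2 ^ (h + k)], so that the chain, with mesh
    [2 ^- h], has mesh [2 ^ k] after dilation and its points can be
    rounded to the lattice. The chain is started at its last point close to
    the origin; [h] is chosen so that regions of radius [2 ^ (k + 48)]
    stay within the distance that separates the chain from the set, and [l] so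
    that the dilated set lies in the ball that the walk leaves for good. *)
Lemma surrounding_corridor (G : set (R * R)) : does_not_surround_origin G ->
  exists M l B h (Y : nat -> nat -> Z2), forall k, (3 <= k)%N ->
    corridor k M l B (Y k) /\
    forall q x, region k M l (Y k) q x -> ~ dilate (2 ^ (h + k)) G (Z2_to_R2 R x).
Proof.
move=> [c1 [c10 Gc1 [c2 [c3 [f1 [f2 [df1 [df2 [[_ c30] f0 f1c1 fd finf]]]]]]]]].
have fclear s : 0 <= s <= 1 -> clear G c3 (f1 s, f2 s).
  move=> s01 y Gy; rewrite -lee_fin; apply: le_trans finf _.
  by apply: ereal_inf_lbound; exists s, y.
pose K : R := 2 ^+ 48.
have K2 : 2 <= K.
  have : 1 <= 2 ^+ 47 :> R by rewrite exprn_ege1 // ler1n.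
  by rewrite /K exprS; lra.
have [h hh] := exp2_unbounded (3 * K / c3).
have [l hl] := exp2_unbounded (2 * c1 * 2 ^+ h).
set H : R := 2 ^+ h in hh hl.
have H0 : 0 < H by rewrite exprn_gt0.
rewrite ler_pdivrMr // in hh.
have eta0 : 0 < H^-1 by rewrite invr_gt0.
have c0 : clear G c3 0 by have := fclear 0; rewrite f0; apply; rewrite lexx ler01.
have [w [m [z [z0 zm zs zc]]] wC] := reach_radial eta0 c10 f1c1 (fun y Gy => Gc1 y Gy)
  (reach_path eta0 f0 (fun s s01 => let: And3 a b _ := fd s s01 in conj a b) fclear)
  ((2 ^+ (l + 40) + 9) * H^-1).
have l40 : 0 <= 2 ^+ (l + 40) :> R by rewrite exprn_ge0.
(* The last point of the chain at distance at most [8 * 2 ^- h] from the origin. *)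
pose near0 j := (j <= m)%N && (norm1 (z j) <= 8 * H^-1).
have ex0 : exists j, near0 j.
  by exists 0%N; rewrite /near0 leq0n z0 /norm1 /= normr0 addr0 mulr_ge0 // ltW.
have le_m j : near0 j -> (j <= m)%N by case/andP.
case: (ex_maxnP ex0 le_m) => j0 /andP[j0m zj0] j0max.
have j0lt : (j0 < m)%N.
  rewrite ltn_neqAle j0m andbT; apply/eqP => j0e.
  by move: zj0; rewrite j0e zm; move: wC; rewrite mulrDl; have := mulr_ge0 l40 (ltW eta0); lra.
have far j : (j0 < j <= m)%N -> 8 * H^-1 <= norm1 (z j).
  move=> /andP[jj jm]; rewrite leNgt; apply/negP => zj.
  by have := j0max j; rewrite /near0 jm (ltW zj) => /(_ isT); rewrite leqNgt jj.
have idx i : (i < m - j0)%N -> (j0 < j0.+1 + i <= m)%N.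
  by rewrite addSn ltnS leq_addr /= -ltn_subRL.
pose Z := \sum_(j < m.+1) norm1 (z j).
have zZ j : (j <= m)%N -> norm1 (z j) <= Z.
  rewrite -ltnS => jm; rewrite /Z (bigD1 (Ordinal jm)) //= lerDl sumr_ge0 // => i _.
  by rewrite addr_ge0.
have [B hB] := exp2_unbounded (H * Z + K + 3).
pose pt i := z (j0.+1 + i)%N.
pose Y k i := round (mulp (2 ^ (h + k))%N%:R (pt i)).
exists (m - j0)%N, l, B, h, Y => k k3.
set n : R := (2 ^ (h + k))%N%:R in Y *; pose s : R := 2 ^+ k.
have pw i : (2 ^ (k + i))%N%:R = s * 2 ^+ i :> R by rewrite natrX exprD.
have s8 : 8 <= s.
  rewrite /s -(subnKC k3) exprD (_ : 2 ^+ 3 = 8); last by ring.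
  by rewrite ler_peMr // exprn_ege1 // ler1n.
have nE : n = H * s by rewrite /n natrX exprD.
have n0 : 0 <= n by rewrite nE mulr_ge0 // ltW //; lra.
have nH : n * H^-1 = s by rewrite nE mulrAC divff ?mul1r // lt0r_neq0.
have Kn : 3 * K * s <= n * c3.
  by rewrite nE [leRHS]mulrAC; apply: ler_wpM2r; lra.
have Ks2 : 2 * s <= K * s by apply: ler_wpM2r; lra.
have Yb i : n * norm1 (pt i) - 2 <= (l1norm (Y k i))%:R <= n * norm1 (pt i) + 2.
  by have := l1norm_round_bounds (mulp n (pt i)); rewrite norm1_mulp0.
split.
  split.
  - by rewrite subn_gt0.
  - rewrite -(ler_nat R) pw; have /andP[_ h2] := Yb 0%N; apply: le_trans h2 _.
    have : norm1 (pt 0) <= 9 * H^-1.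
      rewrite /pt addn0; have := zs j0 j0lt; have := norm1D (z j0.+1 - z j0) (z j0).
      by rewrite subrK; lra.
    move=> /(ler_wpM2l n0); rewrite mulrCA nH; lra.
  - move=> i iM; rewrite -(ler_nat R) pw; have /andP[h1 _] := Yb i; apply: le_trans h1.
    have : 8 * H^-1 <= norm1 (pt i) by apply: far; exact: idx.
    move=> /(ler_wpM2l n0); rewrite mulrCA nH; lra.
  - move=> i iM; rewrite -(ltr_nat R) natrD !pw -/K; have /andP[_ h2] := Yb i.
    have hz : norm1 (pt i) <= Z by apply: zZ; have /andP[] := idx i iM.
    have := ler_wpM2l n0 hz; have nZ : n * Z = s * (H * Z) by rewrite nE; ring.
    have s0 : 0 <= s by lra.
    have := ler_wpM2l s0 hB; rewrite nZ; lra.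
  - move=> i iM; rewrite -(ler_nat R) pw.
    apply: le_trans (l1norm_round_le _ _) _; rewrite norm1_mulp //.
    have : norm1 (pt i - pt i.+1) <= H^-1.
      by rewrite -norm1N opprB /pt addnS; apply: zs; have /andP[] := idx i.+1 iM; rewrite addnS.
    move=> /(ler_wpM2l n0); rewrite nH; lra.
  - rewrite -(ler_nat R) -addnA pw.
    have /andP[h1 _] := Yb (m - j0).-1; apply: le_trans h1.
    have -> : pt (m - j0).-1 = w by rewrite /pt addSnnS prednK ?subn_gt0 // subnKC.
    move: (ler_wpM2l n0 wC); rewrite mulrCA nH mulrDl addnS exprS.
    have : 1 <= 2 ^+ (l + 39) :> R by rewrite exprn_ege1 // ler1n.
    nra.
move=> q x rx [y Gy yx].
have xE : Z2_to_R2 R x = mulp n y by rewrite -yx.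
have xn : (l1norm x)%:R = norm1 (mulp n y) by rewrite l1normE xE.
case: q rx => [|j] /=.
  rewrite -(ler_nat R) pw xn; have := enorm_le_norm1 (mulp n y).
  rewrite enorm_mulp //; have := c0 y Gy; rewrite enorm_sub0 => /(ler_wpM2l n0).
  lra.
case: ifP => jM.
  rewrite -(ler_nat R) pw -/K l1normE Z2_to_R2B xE => hx.
  have := zc (j0.+1 + j)%N; rewrite -/(pt j) => /(_ _ y Gy).
  have /andP[_ ->] := idx j jM.
  move=> /(_ isT) /(ler_wpM2l n0); rewrite -enorm_mulp // -mulpB.
  have := enorm_le_norm1 (mulp n (pt j) - mulp n y).
  have := norm1_triangle (Z2_to_R2 R (Y k j)) (mulp n (pt j)) (mulp n y).
  have := round_near (mulp n (pt j)); rewrite -/(Y k j).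
  rewrite -norm1N opprB in hx; lra.
rewrite -(ltr_nat R) pw xn; have := norm1_le_enorm (mulp n y); rewrite enorm_mulp //.
have nc : n * c1 = s * (c1 * H) by rewrite nE; ring.
have := ler_wpM2l n0 (Gc1 y Gy); rewrite nc.
have s0 : 0 <= s by lra.
have := ler_wpM2l s0 hl; lra.
Qed.

End CorridorOfPath.

(** * Infinitely many avoided dilates *)

Section AvoidedDilates.
Context (R : realType) d (T : measurableType d) (P : probability T R).
Variables (x0 : Z2_star) (X : nat -> T -> Z2_star).
Hypothesis hX : markov_chain P (@conditioned_trans R) x0 X.

Definition avoided (G : set (R * R)) (w : T) : set nat :=
  [set n : nat | (0 < n)%N /\ dilate n G `&` walk_range R (fun m => X m w) = set0].

Lemma avoidedE G n w : (0 < n)%N -> avoided G w n <->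
  forall k, ~ dilate n G (Z2_to_R2 R (current (history X k w))).
Proof.
move=> n0; split=> [[_ nG] k kG|H].
  have : (dilate n G `&` walk_range R (fun m => X m w)) (Z2_to_R2 R (val (X k w))).
    by split; [rewrite -current_history|exists k].
  by rewrite nG.
split=> //; apply/seteqP; split=> // v [vG [k _ vk]]; apply: (H k).
by rewrite current_history -[Z2_to_R2 _ _]vk.
Qed.

Lemma measurable_infinite_avoided G : measurable [set w | infinite_set (avoided G w)].
Proof.
have mD n : measurable [set w | avoided G w n].
  have [->|n0] := posnP n.
    rewrite (_ : [set _ | _] = set0); first exact: measurable0.
    by apply/seteqP; split=> w // [].
  rewrite (_ : [set _ | _] = \bigcap_k
      [set w | ~ dilate n G (Z2_to_R2 R (current (history X k w)))]).
    apply: bigcap_measurable => // k _.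
    exact: (measurable_history hX k (fun h => ~ dilate n G (Z2_to_R2 R (current h)))).
  apply/seteqP; split=> w /=; first by move=> /avoidedE H k _; exact: H.
  by move=> H; apply/avoidedE => // k; exact: H.
rewrite (_ : [set _ | _] = \bigcap_m \bigcup_n [set w | (m <= n)%N /\ avoided G w n]).
  apply: bigcap_measurable => // m _; apply: bigcup_measurable => n _.
  case: (leqP m n) => mn; last first.
    rewrite (_ : [set _ | _] = set0); first exact: measurable0.
    by apply/seteqP; split=> w // [].
  rewrite (_ : [set _ | _] = [set w | avoided G w n]); first exact: mD.
  by apply/seteqP; split=> w // [].
apply/seteqP; split=> w /=.
  by move=> /infinite_natP H m _; have [n mn An] := H m; exists n.
move=> H; apply/infinite_natP => m; have [n _ [mn An]] := H m I.
by exists n.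
Qed.

End AvoidedDilates.

Theorem theorem1p5 (R : realType) (d : measure_display) (T : measurableType d)
    (P : probability T R) (x0 : Z2_star) (hx0 : nn 0 (val x0))
    (S : nat -> T -> Z2_star)
    (hS : markov_chain P (@conditioned_trans R) x0 S)
    (G : set (R * R)) (hG : does_not_surround_origin G) :
  P [set w | infinite_set [set n : nat |
       (0 < n)%N /\ dilate n G `&` walk_range R (fun m => S m w) = set0]] = 1%E.
Proof.
have mE := measurable_infinite_avoided hS G.
have [M [l [B [h [Y cor]]]]] := surrounding_corridor hG.
pose C : R := 108 * B%:R + 432.
have [i0 i03 i0C] : exists2 i0, (3 <= i0)%N & C <= 3 / 16 * i0%:R.
  have C0 : 0 <= C * 16 / 3 by rewrite /C; have : 0 <= B%:R :> R := ler0n _ _; lra.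
  exists (3 + Num.bound (C * 16 / 3))%N; first exact: leq_addr.
  by move: (Num.bound _) (archi_boundP C0) => N hN; rewrite natrD; lra.
have i_le_scale i : (i <= scale B i)%N by rewrite /scale mulSn leq_addr.
have scale3 i : (i0 <= i)%N -> (3 <= scale B i)%N.
  by move=> ii; apply: leq_trans i03 (leq_trans ii (i_le_scale i)).
have scale_large i : (i0 <= i)%N -> C <= level R (scale B i).
  move=> ii; apply: le_trans (level_ge R (scale B i)).
  have : i0%:R <= (scale B i)%:R :> R by rewrite ler_nat (leq_trans ii).
  lra.
have null := eventually_fail_null hS (leq_trans (isT : (0 < 3)%N) i03)
  (fun i ii => (cor _ (scale3 i ii)).1) scale_large.
suff : P [set w | infinite_set (avoided S G w)] = 1%E by [].
have : P (~` [set w | infinite_set (avoided S G w)]) = 0%E.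
  apply/negligibleP; first exact: measurableC.
  apply: (negligibleS (A := \bigcup_m eventually_fail S M l B (fun i => Y (scale B i)) m)).
    move=> w /= finite_w; apply: contrapT => H; apply: finite_w; apply/infinite_natP => m.
    have : ~ eventually_fail S M l B (fun i => Y (scale B i)) (m + i0) w.
      by move=> Hw; apply: H; exists (m + i0)%N.
    move=> /existsNP[i /not_implyP[mi /forallNP Hi]].
    have ii : (i0 <= i)%N by apply: leq_trans mi; rewrite leq_addl.
    have imi : (m <= i)%N by apply: leq_trans mi; rewrite leq_addr.
    exists (2 ^ (h + scale B i))%N.
      apply: leq_trans imi _; apply: leq_trans (i_le_scale i) _.
      by apply: leq_trans (ltnW (ltn_expl _ (isT : (1 < 2)%N))) _; rewrite leq_exp2l ?leq_addl.
    apply/avoidedE; first by rewrite expn_gt0.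
    move=> k; have /negP := Hi k; rewrite negbK /survives.
    case E: stage => [q|//] _.
    have [c avoid] := cor _ (scale3 i ii).
    exact: avoid (stage_region c E).
  apply: negligible_bigcup => m; apply/negligibleP; last exact: null.
  exact: measurable_eventually_fail hS _ _ _ _ _.
rewrite probability_setC // (prE P mE) -EFinB => -[e].
by congr EFin; lra.
Qed.
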